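(* Let $n\geq 3$ be an integer. If $n$ is odd, then \[ \mathrm{Ind}(E_{2n+2}) \simeq \begin{cases} S^{2k+1} \vee S^{2k+1} \vee S^{2k+1} & \text{if } n=4k+1, \\ S^{2k+2} & \text{if } n=4k+3. \end{cases}\] If $n$ is even, then \[ \mathrm{Ind}(E_{2n+2}) \simeq \begin{cases} S^{2k} & \text{if } n=6k, \\ S^{2k+1}\vee S^{2k+1} & \text{if } n=6k+2, \\ S^{2k+2} & \text{if } n=6k+4. \end{cases}\]
   Context: For a graph $G$, the independence complex $\mathrm{Ind}(G)$ is the simplicial complex whose vertices are the vertices of $G$ and whose faces are the independent sets of $G$. Let $n\ge 2$; all vertex indices below are taken modulo $2n+2$. Let $K_{n+1,n+1}$ be the complete bipartite graph on vertex set $\{1,2,\ldots,2n+2\}$ with bipartition into odd and even numbers. Let $DC_{2n+2}$ be the graph on vertex set $\{c_1,\ldots,c_{2n+2}\}$ with edges $\{c_i,c_{i+1}\}$ for $i\in[2n+2]$ and $\{c_i,c_{i+n+1}\}$ for $i\in[n+1]$ (a $(2n+2)$-cycle with antipodal chords). Let $C_{n+1}$ be the cycle on vertex set $\{c_1,c_3,\ldots,c_{2n+1}\}$ with edges $\{c_i,c_{i+2}\}$ for odd $i$. The graph $E_{2n+2}$ is defined as follows: if $n$ is odd, take disjoint copies of $K_{n+1,n+1}$ and $DC_{2n+2}$ and add an edge joining each vertex $i$ of $K_{n+1,n+1}$ to $c_i$; if $n$ is even, take disjoint copies of $K_{n+1,n+1}$ and $C_{n+1}$ and add edges joining each vertex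 $c_i$ of $C_{n+1}$ to the vertices $i$ and $i+n+1$ of $K_{n+1,n+1}$. $\simeq$ denotes homotopy equivalence and $\vee$ wedge sum. *)

(* Defs.v *)
From HB Require Import structures.
From mathcomp Require Import all_boot all_order all_algebra.
From mathcomp Require Import all_classical all_reals all_analysis homotopy.

Set Implicit Arguments.
Unset Strict Implicit.
Unset Printing Implicit Defensive.

Import Order.TTheory GRing.Theory Num.Theory.
Import numFieldNormedType.Exports.

Local Open Scope classical_set_scope.
Local Open Scope ring_scope.

(** * Finite simple graphs *)

Record sgraph := SGraph {
  vertex :> finType;
  edge : rel vertex;
  edge_sym : symmetric edge;
  edge_irr : irreflexive edge }.

Arguments edge : clear implicits.

(* The simple graph whose edges are the pairs {x, y}, x != y, with [r x y]:
   [r] need only list each edge in one direction. *)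
Section GraphOfPairs.
Variables (V : finType) (r : rel V).

Definition pairs_edge : rel V := fun x y => (x != y) && (r x y || r y x).

Fact pairs_edge_sym : symmetric pairs_edge.
Proof. by move=> x y; rewrite /pairs_edge eq_sym orbC. Qed.

Fact pairs_edge_irr : irreflexive pairs_edge.
Proof. by move=> x; rewrite /pairs_edge eqxx. Qed.

Definition graph_of_pairs := SGraph pairs_edge_sym pairs_edge_irr.
End GraphOfPairs.

(* Disjoint copies of [G] and [H], together with the edges {x, y}
   for [x] in [G] and [y] in [H] such that [r x y]. *)
Section Attach.
Variables (G H : sgraph) (r : G -> H -> bool).

Definition attach_edge : rel (G + H)%type := fun u v =>
  match u, v with
  | inl x, inl x' => edge G x x'
  | inr y, inr y' => edge H y y'
  | inl x, inr y | inr y, inl x => r x y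
  end.

Fact attach_edge_sym : symmetric attach_edge.
Proof. by case=> [x|y] [x'|y'] //=; exact: edge_sym. Qed.

Fact attach_edge_irr : irreflexive attach_edge.
Proof. by case=> [x|y] /=; exact: edge_irr. Qed.

Definition attach := SGraph attach_edge_sym attach_edge_irr.
End Attach.

(** * The graphs E_(2n+2) *)

(* Indices modulo 2n+2 are represented by their residues in {0, ..., 2n+1};
   the index 2n+2 is the residue 0. Parity is well defined modulo 2n+2. *)
Notation idx n := 'I_(2 * n + 2).

Definition shifted (n d i j : nat) : bool := (j == i + d %[mod 2 * n + 2])%N.

Definition K_graph (n : nat) : sgraph :=
  graph_of_pairs (fun i j : idx n => odd i && ~~ odd j).

Definition DC_graph (n : nat) : sgraph :=
  graph_of_pairs (fun i j : idx n =>
    shifted n 1 i j || ((1 <= i <= n + 1)%N && shifted n (n + 1) i j)).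

Definition C_graph (n : nat) : sgraph :=
  graph_of_pairs (fun i j : {i : idx n | odd i} =>
    shifted n 2 (val i) (val j)).

Definition E_odd (n : nat) : sgraph :=
  @attach (K_graph n) (DC_graph n) (fun i j : idx n => i == j).

Definition E_even (n : nat) : sgraph :=
  @attach (K_graph n) (C_graph n)
    (fun (i : idx n) (c : {c : idx n | odd c}) =>
       (i == val c) || shifted n (n + 1) (val c) i).

Definition E_graph (n : nat) : sgraph := if odd n then E_odd n else E_even n.

(** * Simplicial complexes *)

Record complex (V : finType) := Complex {
  face :> {set {set V}};
  face_vertex : forall v, [set v]%SET \in face;
  face_sub : forall A B : {set V}, A \subset B -> B \in face -> A \in face }.

Section IndependenceComplex.
Variable G : sgraph.

Definition independent (A : {set G}) : bool :=
  [forall x in A, forall y in A, ~~ edge G x y].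

Definition ind_face : {set {set G}} := [set A | independent A]%SET.

Fact ind_face_vertex v : [set v]%SET \in ind_face.
Proof.
rewrite inE; apply/forall_inP => x /set1P ->; apply/forall_inP => y /set1P ->.
by rewrite edge_irr.
Qed.

Fact ind_face_sub (A B : {set G}) :
  A \subset B -> B \in ind_face -> A \in ind_face.
Proof.
move=> /fintype.subsetP AB; rewrite !inE => /forall_inP indB.
apply/forall_inP => x xA; apply/forall_inP => y yA.
by have /forall_inP/(_ y (AB y yA)) := indB x (AB x xA).
Qed.

Definition Ind : complex G := Complex ind_face_vertex ind_face_sub.
End IndependenceComplex.

(* Points are given by barycentric coordinates; as [V] is finite, the usual
   topology of |K| is the one induced by the product topology. *)
Definition realization_set (R : realType) (V : finType) (K : complex V) :
    set {ptws V -> R} :=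
  [set t | [/\ forall v, 0 <= t v, \sum_(v : V) t v = 1
             & [set v | t v != 0]%SET \in face K]].

Arguments realization_set R {V} K.

Definition realization (R : realType) (V : finType) (K : complex V) :
    topologicalType :=
  set_type (realization_set R K).

(** * Homotopy equivalence *)

Definition homotopic (R : realType) (X Y : topologicalType) (f g : X -> Y) :=
  exists H : R * X -> Y,
    [/\ {within `[0, 1] `*` setT, continuous H},
        forall x, H (0, x) = f x & forall x, H (1, x) = g x].

Definition homotopy_equiv (R : realType) (X Y : topologicalType) :=
  exists (f : X -> Y) (g : Y -> X),
    [/\ continuous f, continuous g,
        homotopic R (g \o f) id & homotopic R (f \o g) id].

(** * Spheres and their wedge sums *)

Definition sphere_set (R : realType) (d : nat) : set 'rV[R]_d.+1 :=
  [set x | \sum_i x 0 i ^+ 2 = 1].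

Arguments sphere_set : clear implicits.

Definition sphere (R : realType) (d : nat) : topologicalType :=
  set_type (sphere_set R d).

Fact sphere_point_subproof (R : realType) (d : nat) :
  (delta_mx 0 0 : 'rV[R]_d.+1) \in sphere_set R d.
Proof.
rewrite inE /sphere_set /= (bigD1 ord0) //= big1 => [|i i0]; rewrite mxE.
  by rewrite eqxx expr1n addr0.
by rewrite (negbTE i0) andbF expr0n.
Qed.

Definition sphere_point (R : realType) (d : nat) : sphere R d :=
  exist (fun x => x \in sphere_set R d) _ (sphere_point_subproof R d).

(* The wedge of [m] copies of the [d]-sphere. *)
Definition sphere_wedge (R : realType) (m d : nat) : topologicalType :=
  @wedge 'I_m (fun=> sphere R d) (fun=> sphere_point R d).

(* Main.v *)
Require Import Defs.
From mathcomp Require Import all_boot all_order all_algebra.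
From mathcomp Require Import all_classical all_reals all_analysis homotopy.
From mathcomp Require Import lra zify.

(* In |Ind(G)| a pair {u, v} of compatible vertices (u = v allowed) can be made
   incompatible without changing the homotopy type whenever some vertex a is
   compatible with everything compatible with both u and v: push the mass
   min(t_u, t_v) from u and v to a along straight lines. In terms of graphs this
   adds or deletes an edge, or deletes a vertex.

   Deleting the edges joining one odd and one even vertex of K_{n+1,n+1} to the
   other part H, then folding each side of K_{n+1,n+1} onto these two vertices,
   leaves the disjoint union of K_2 and H. For H = C_m, adding x_0x_4 and
   deleting x_0x_1 and x_3 splits off the edge x_1x_2 and leaves C_{m-3}. For a
   ladder with rungs u_iw_i, adding u_0w_3, w_0u_3 and deleting u_0u_1, w_0w_1,
   u_2u_3, w_2w_3 splits off the square on rungs 1 and 2, which folds to an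
   edge, and leaves the ladder on m-2 rungs with an additional twist. One ends
   with d disjoint edges, whose independence complex is the boundary of a
   cross-polytope, or with d disjoint edges and K_{q+1}, whose independence
   complex consists of q+1 cones over a (d-1)-sphere; by moves of the same kind
   the latter becomes a bouquet of q cross-polytope boundaries. *)

Set Implicit Arguments.
Unset Strict Implicit.
Unset Printing Implicit Defensive.

Import Order.TTheory GRing.Theory Num.Theory.
Import numFieldNormedType.Exports.

Local Open Scope classical_set_scope.
Local Open Scope ring_scope.

(** * Homotopies *)

Lemma continuous_into_set_type (X Y : topologicalType) (A : set Y)
    (f : X -> set_type A) :
  continuous (fun x => set_val (f x)) -> continuous f.
Proof.
move=> cf; apply/continuousP => _ [B oB <-].
by move/continuousP: cf => /(_ _ oB).
Qed.

Lemma continuous_set_val (X : topologicalType) (A : set X) :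
  continuous (set_val : set_type A -> X).
Proof. exact: initial_continuous. Qed.

Lemma continuous_into_ptws (X Y : topologicalType) (V : eqType)
    (f : X -> {ptws V -> Y}) :
  (forall v, continuous (fun x => f x v)) -> continuous f.
Proof.
move=> cf x; apply/cvg_sup => v; apply/cvg_image => [|A].
  rewrite eqEsubset; split => [y //|y _].
  by exists (fun w => if w == v then y else f x w); rewrite ?/proj ?eqxx.
move=> /cf; rewrite nbhs_simpl /= => Af.
exists ((fun g : V -> Y => g v) @^-1` A) => //.
rewrite eqEsubset; split => [y [g Ag <-]//|y Ay].
by exists (fun w => if w == v then y else f x w); rewrite /= ?/proj ?eqxx.
Qed.

Lemma continuous_pair (X Y Z : topologicalType) (f : X -> Y) (g : X -> Z) :
  continuous f -> continuous g -> continuous (fun x => (f x, g x)).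
Proof.
by move=> cf cg x; apply: (@cvg_pair _ _ _ (nbhs x)); [exact: cf|exact: cg].
Qed.

Lemma continuous_fst (X Y : topologicalType) : continuous (@fst X Y).
Proof. by move=> x; exact: cvg_fst. Qed.

Lemma continuous_snd (X Y : topologicalType) : continuous (@snd X Y).
Proof. by move=> x; exact: cvg_snd. Qed.

Lemma continuous_compose (X Y Z : topologicalType) (f : X -> Y) (g : Y -> Z) :
  continuous f -> continuous g -> continuous (g \o f).
Proof. by move=> cf cg x; apply: continuous_comp; [exact: cf|exact: cg]. Qed.

Lemma continuous_const (X Y : topologicalType) (y : Y) :
  continuous (fun _ : X => y).
Proof. by move=> x; exact: cvg_cst. Qed.

Lemma continuous_ptws_eval (Y : topologicalType) (V : eqType) (v : V) :
  continuous (fun f : {ptws V -> Y} => f v).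
Proof. exact: (@proj_continuous V (fun=> Y) v). Qed.

Section RealContinuity.
Variables (R : realType) (T : topologicalType).
Implicit Types f g : T -> R.

Lemma continuous_addr f g : continuous f -> continuous g ->
  continuous (fun x => f x + g x).
Proof. by move=> cf cg x; apply: cvgD; [exact: cf|exact: cg]. Qed.

Lemma continuous_subr f g : continuous f -> continuous g ->
  continuous (fun x => f x - g x).
Proof. by move=> cf cg x; apply: cvgB; [exact: cf|exact: cg]. Qed.

Lemma continuous_mulr f g : continuous f -> continuous g ->
  continuous (fun x => f x * g x).
Proof. by move=> cf cg x; apply: cvgM; [exact: cf|exact: cg]. Qed.

Lemma continuous_divr f g : continuous f -> continuous g ->
  (forall x, g x != 0) -> continuous (fun x => f x / g x).
Proof.
move=> cf cg g0 x; apply: cvgM; first exact: cf.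
by apply: cvgV; [exact: g0|exact: cg].
Qed.

Lemma continuous_maxr f g : continuous f -> continuous g ->
  continuous (fun x => Num.max (f x) (g x)).
Proof.
by move=> cf cg x; apply: (@continuous_max R T f g x); [exact: cf|exact: cg].
Qed.

Lemma continuous_minr f g : continuous f -> continuous g ->
  continuous (fun x => Num.min (f x) (g x)).
Proof.
by move=> cf cg x; apply: (@continuous_min R T f g x); [exact: cf|exact: cg].
Qed.

Lemma continuous_sumr (I : Type) (r : seq I) (P : pred I) (F : I -> T -> R) :
  (forall i, P i -> continuous (F i)) ->
  continuous (fun x => \sum_(i <- r | P i) F i x).
Proof.
move=> cF; elim: r => [|i r IHr].
  by under eq_fun do rewrite big_nil; move=> x; exact: cvg_cst.
under eq_fun do rewrite big_cons.
by have [/cF cFi|//] := boolP (P i); exact: continuous_addr.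
Qed.

End RealContinuity.

Section Homotopy.
Variable R : realType.
Implicit Types X Y Z : topologicalType.

Definition clamp01 (s : R) : R := Num.max 0 (Num.min s 1).

Lemma clamp01_continuous : continuous clamp01.
Proof.
apply: continuous_maxr; first by move=> s; exact: cvg_cst.
by apply: continuous_minr => s; [exact: cvg_id|exact: cvg_cst].
Qed.

Lemma clamp01_itv s : 0 <= clamp01 s <= 1.
Proof. by rewrite /clamp01 le_max lexx /= ge_max ler01 ge_min lexx orbT. Qed.

Lemma clamp01_id s : 0 <= s <= 1 -> clamp01 s = s.
Proof. by move=> /andP[s0 s1]; rewrite /clamp01 min_l// max_r. Qed.

Lemma continuous_homotopic X Y (f g : X -> Y) (H : R * X -> Y) :
  continuous H -> (forall x, H (0, x) = f x) -> (forall x, H (1, x) = g x) ->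
  homotopic R f g.
Proof.
by move=> cH H0 H1; exists H; split => //; exact: continuous_subspaceT.
Qed.

Lemma homotopic_continuous X Y (f g : X -> Y) :
  homotopic R f g -> exists H : R * X -> Y,
    [/\ continuous H, forall x, H (0, x) = f x & forall x, H (1, x) = g x].
Proof.
case=> H [/subspace_sigL_continuousP cH H0 H1].
have clampP (p : R * X) : (clamp01 p.1, p.2) \in `[0, 1] `*` [set: X].
  by rewrite inE; split => //=; rewrite in_itv /= clamp01_itv.
exists (fun p => H (clamp01 p.1, p.2)); split => [|x|x]; last 2 first.
- by rewrite /= clamp01_id ?H0// lexx ler01.
- by rewrite /= clamp01_id ?H1// lexx ler01.
pose h (p : R * X) : set_type (`[0, 1] `*` [set: X]) :=
  exist (fun q => q \in _) _ (clampP p).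
have ch : continuous h.
  apply: continuous_into_set_type.
  apply: (@continuous_pair _ _ _ (@clamp01 \o fst) snd).
    apply: continuous_compose; first exact: continuous_fst.
    exact: clamp01_continuous.
  exact: continuous_snd.
exact: (@continuous_compose _ _ _ h _ ch cH).
Qed.

Lemma homotopic_refl X Y (f : X -> Y) : continuous f -> homotopic R f f.
Proof.
move=> cf; apply: (@continuous_homotopic _ _ _ _ (f \o snd)) => // p.
by apply: continuous_comp; [exact: cvg_snd|exact: cf].
Qed.

Lemma homotopic_trans X Y (f g h : X -> Y) :
  homotopic R f g -> homotopic R g h -> homotopic R f h.
Proof.
move=> /homotopic_continuous[H [cH H0 H1]].
move=> /homotopic_continuous[K [cK K0 K1]].
pose A (p : R * X) := H (2 * p.1, p.2).
pose B (p : R * X) := K (2 * p.1 - 1, p.2).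
pose L p := if p.1 <= 2^-1 then A p else B p.
have cA : continuous A.
  apply: (@continuous_compose _ _ _ (fun p : R * X => (2 * p.1, p.2)) H) => //.
  apply: continuous_pair; last exact: continuous_snd.
  apply: continuous_mulr; last exact: continuous_fst.
  by move=> p; exact: cvg_cst.
have cB : continuous B.
  apply: (@continuous_compose _ _ _
    (fun p : R * X => (2 * p.1 - 1, p.2)) K) => //.
  apply: continuous_pair; last exact: continuous_snd.
  apply: continuous_subr; last by move=> p; exact: cvg_cst.
  apply: continuous_mulr; last exact: continuous_fst.
  by move=> p; exact: cvg_cst.
have LB p : 2^-1 <= p.1 -> L p = B p.
  rewrite /L le_eqVlt => /predU1P[ph|]; last by rewrite ltNge => /negbTE ->.
  by rewrite -ph lexx /A /B -ph mulfV ?pnatr_eq0// subrr H1 K0.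
have c1 : closed [set p : R * X | p.1 <= 2^-1].
  apply: (@closed_comp _ _ (@fst R X) [set r | r <= 2^-1]).
    by move=> p _; exact: cvg_fst.
  exact: closed_le.
have c2 : closed [set p : R * X | 2^-1 <= p.1].
  apply: (@closed_comp _ _ (@fst R X) [set r | 2^-1 <= r]).
    by move=> p _; exact: cvg_fst.
  exact: closed_ge.
apply: (@continuous_homotopic _ _ _ _ L) => [|x|x]; last 2 first.
- by rewrite /L /A /= invr_ge0 ler0n mulr0 H0.
- have h1 : 2^-1 <= (1 : R) by lra.
  have h2 : 2 * 1 - 1 = 1 :> R by lra.
  by rewrite (LB (1, x) h1) /B /= h2 K1.
apply/continuous_closedP => C cC.
rewrite (_ : L @^-1` C = ([set p : R * X | p.1 <= 2^-1] `&` A @^-1` C) `|`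
                         ([set p : R * X | 2^-1 <= p.1] `&` B @^-1` C)).
  apply: closedU; apply: closedI => //.
  - by move/continuous_closedP: cA; exact.
  - by move/continuous_closedP: cB; exact.
rewrite eqEsubset; split => p /=.
  have [ph|/ltW ph] := leP p.1 2^-1; first by rewrite /L ph; left.
  by rewrite LB//; right.
by case=> -[ph]; [rewrite /L ph|rewrite LB].
Qed.

Lemma homotopic_compl X Y Z (f g : X -> Y) (k : Y -> Z) :
  continuous k -> homotopic R f g -> homotopic R (k \o f) (k \o g).
Proof.
move=> ck /homotopic_continuous[H [cH H0 H1]].
apply: (@continuous_homotopic _ _ _ _ (k \o H)) => [p|x|x] /=.
- by apply: continuous_comp; [exact: cH|exact: ck].
- by rewrite H0.
- by rewrite H1.
Qed.

Lemma homotopic_compr X Y Z (f g : Y -> Z) (k : X -> Y) :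
  continuous k -> homotopic R f g -> homotopic R (f \o k) (g \o k).
Proof.
move=> ck /homotopic_continuous[H [cH H0 H1]].
apply: (@continuous_homotopic _ _ _ _ (fun p => H (p.1, k p.2))) => //.
apply: (@continuous_compose _ _ _ (fun p : R * X => (p.1, k p.2)) H) => //.
apply: continuous_pair; first exact: continuous_fst.
by apply: (@continuous_compose _ _ _ snd k) => //; exact: continuous_snd.
Qed.

Lemma homotopy_equiv_sym X Y : homotopy_equiv R X Y -> homotopy_equiv R Y X.
Proof. by case=> f [g [cf cg gf fg]]; exists g, f. Qed.

Lemma homotopy_equiv_trans X Y Z :
  homotopy_equiv R X Y -> homotopy_equiv R Y Z -> homotopy_equiv R X Z.
Proof.
case=> f [g [cf cg gf fg]] [h [k [ch ck kh hk]]].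
exists (h \o f), (g \o k); split.
- by move=> x; apply: continuous_comp; [exact: cf|exact: ch].
- by move=> x; apply: continuous_comp; [exact: ck|exact: cg].
- apply: homotopic_trans gf.
  exact: (homotopic_compl cg (homotopic_compr cf kh)).
- apply: homotopic_trans hk.
  exact: (homotopic_compl ch (homotopic_compr ck fg)).
Qed.

Lemma homeomorphic_equiv X Y (f : X -> Y) (g : Y -> X) :
  continuous f -> continuous g -> cancel f g -> cancel g f ->
  homotopy_equiv R X Y.
Proof.
move=> cf cg fK gK; exists f, g; split => //.
- have -> : g \o f = id by exact/funext.
  by apply: homotopic_refl => x; exact: cvg_id.
- have -> : f \o g = id by exact/funext.
  by apply: homotopic_refl => x; exact: cvg_id.
Qed.

End Homotopy.

(** * Realizations of flag complexes *)

Definition flag_set (R : realType) (V : finType) (c : rel V) :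
    set {ptws V -> R} :=
  [set t | [/\ forall v, 0 <= t v, \sum_(v : V) t v = 1
             & forall x y, t x != 0 -> t y != 0 -> c x y]].

Arguments flag_set R {V} c.

Definition flag_real (R : realType) (V : finType) (c : rel V) :
    topologicalType :=
  set_type (flag_set R c).

Lemma realization_Ind (R : realType) (G : sgraph) :
  realization R (Ind G) = flag_real R (fun x y : G => ~~ edge G x y).
Proof.
rewrite /realization /flag_real; congr set_type.
rewrite eqEsubset; split => t [t0 t1 tc]; split => //.
  move=> x y tx ty; move: tc; rewrite inE => /forall_inP/(_ x).
  by rewrite inE tx => /(_ isT)/forall_inP/(_ y); rewrite inE ty; exact.
rewrite inE; apply/forall_inP => x; rewrite inE => tx.
by apply/forall_inP => y; rewrite inE; exact: tc.
Qed.

Section FlagReal.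
Variable R : realType.

Definition crd (V : finType) (c : rel V) (t : flag_real R c) (v : V) : R :=
  (set_val t : {ptws V -> R}) v.

Lemma crd_continuous (V : finType) (c : rel V) (v : V) :
  continuous (fun t : flag_real R c => crd t v).
Proof.
apply: (@continuous_compose _ _ _ set_val (fun f : {ptws V -> R} => f v)).
  exact: continuous_set_val.
exact: continuous_ptws_eval.
Qed.

Lemma crdP (V : finType) (c : rel V) (t : flag_real R c) :
  [/\ forall v, 0 <= crd t v, \sum_v crd t v = 1
    & forall x y, crd t x != 0 -> crd t y != 0 -> c x y].
Proof. exact: (set_valP t). Qed.

Definition flag_point (V : finType) (c : rel V) (t : V -> R)
    (ct : flag_set R c t) : flag_real R c :=
  exist (fun x => x \in flag_set R c) t (mem_set ct).

Lemma crd_point (V : finType) (c : rel V) (t : V -> R)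
    (ct : flag_set R c t) : crd (flag_point ct) = t.
Proof. by []. Qed.

Lemma crd_inj (V : finType) (c : rel V) (s t : flag_real R c) :
  crd s =1 crd t -> s = t.
Proof. by move=> st; apply: val_inj; exact/funext. Qed.

Lemma continuous_into_flag (X : topologicalType) (V : finType) (c : rel V)
    (f : X -> flag_real R c) :
  (forall v, continuous (fun x => crd (f x) v)) -> continuous f.
Proof.
by move=> cf; apply: continuous_into_set_type; exact: continuous_into_ptws.
Qed.

Lemma straight_homotopic (X : topologicalType) (V : finType) (c : rel V)
    (f g : X -> flag_real R c) :
  continuous f -> continuous g ->
  (forall p x y, (crd (f p) x != 0) || (crd (g p) x != 0) ->
                 (crd (f p) y != 0) || (crd (g p) y != 0) -> c x y) ->
  homotopic R f g.
Proof.
move=> cf cg fgc.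
pose h (p : R * X) v : R :=
  (1 - clamp01 p.1) * crd (f p.2) v + clamp01 p.1 * crd (g p.2) v.
have hP p : flag_set R c (h p).
  have /andP[s0 s1] := clamp01_itv p.1.
  have [f0 f1 _] := crdP (f p.2); have [g0 g1 _] := crdP (g p.2).
  split=> [v||x y].
  - by rewrite addr_ge0 ?mulr_ge0 ?subr_ge0.
  - by rewrite big_split -!mulr_sumr /= f1 g1 !mulr1 subrK.
  have hn0 v : h p v != 0 -> (crd (f p.2) v != 0) || (crd (g p.2) v != 0).
    apply: contraR; rewrite negb_or !negbK => /andP[/eqP fv /eqP gv].
    by rewrite /h fv gv !mulr0 addr0.
  by move=> /hn0 hx /hn0 hy; exact: fgc hx hy.
apply: (@continuous_homotopic _ _ _ _ _ (fun p => flag_point (hP p))).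
- apply: continuous_into_flag => v.
  have c1 : continuous (fun p : R * X => clamp01 p.1).
    by apply: (@continuous_compose _ _ _ fst (@clamp01 R));
      [exact: continuous_fst|exact: clamp01_continuous].
  apply: continuous_addr; apply: continuous_mulr => //.
  + by apply: continuous_subr => // p; exact: cvg_cst.
  + apply: (@continuous_compose _ _ _ snd (fun x => crd (f x) v)).
      exact: continuous_snd.
    apply: (@continuous_compose _ _ _ f (fun t => crd t v)) => //.
    exact: crd_continuous.
  + apply: (@continuous_compose _ _ _ snd (fun x => crd (g x) v)).
      exact: continuous_snd.
    apply: (@continuous_compose _ _ _ g (fun t => crd t v)) => //.
    exact: crd_continuous.
- move=> x; apply: crd_inj => v.
  by rewrite crd_point /h /= clamp01_id ?lexx ?ler01// subr0 mul1r mul0r addr0.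
- move=> x; apply: crd_inj => v.
  by rewrite crd_point /h /= clamp01_id ?lexx ?ler01// subrr mul1r mul0r add0r.
Qed.

Lemma straight_equiv (V W : finType) (c : rel V) (d : rel W)
    (f : flag_real R c -> flag_real R d) (g : flag_real R d -> flag_real R c) :
  continuous f -> continuous g ->
  (forall t x y, (crd (g (f t)) x != 0) || (crd t x != 0) ->
                 (crd (g (f t)) y != 0) || (crd t y != 0) -> c x y) ->
  (forall t x y, (crd (f (g t)) x != 0) || (crd t x != 0) ->
                 (crd (f (g t)) y != 0) || (crd t y != 0) -> d x y) ->
  homotopy_equiv R (flag_real R c) (flag_real R d).
Proof.
move=> cf cg gf fg; exists f, g; split => //.
  apply: straight_homotopic => //; first exact: continuous_compose.
  by move=> x; exact: cvg_id.
apply: straight_homotopic => //; first exact: continuous_compose.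
by move=> x; exact: cvg_id.
Qed.

Section Push.
Variables (V W : finType) (c : rel V) (d : rel W) (f : V -> W).
Hypothesis fcd :
  forall x y, c x x -> c y y -> c x y -> d (f x) (f y).

Definition push_crd (t : V -> R) (w : W) : R := \sum_(v | f v == w) t v.

Lemma push_crd_neq0 (t : V -> R) w : push_crd t w != 0 ->
  exists2 v, f v = w & t v != 0.
Proof.
move=> tw; apply/exists2P; apply: contrapT => /forallNP nt; move/eqP: tw; apply.
by apply: big1 => v /eqP fv; apply/eqP/negPn/negP => tv; exact: (nt v).
Qed.

Lemma push_subproof (t : flag_real R c) : flag_set R d (push_crd (crd t)).
Proof.
have [t0 t1 tc] := crdP t; split=> [w||x y].
- exact: sumr_ge0.
- by rewrite -t1 (partition_big f xpredT).
move=> /push_crd_neq0[v <- tv] /push_crd_neq0[w <- tw].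
by apply: fcd; exact: tc.
Qed.

Definition push (t : flag_real R c) : flag_real R d :=
  flag_point (push_subproof t).

Lemma push_continuous : continuous push.
Proof.
apply: continuous_into_flag => w; apply: continuous_sumr => v _.
exact: crd_continuous.
Qed.

End Push.

Lemma pushK (V W : finType) (c : rel V) (d : rel W) (f : V -> W) (g : W -> V)
    (fcd : forall x y, c x x -> c y y -> c x y -> d (f x) (f y))
    (gdc : forall x y, d x x -> d y y -> d x y -> c (g x) (g y))
    (t : flag_real R c) :
  (forall v, crd t v != 0 -> g (f v) = v) -> push gdc (push fcd t) = t.
Proof.
move=> gf; apply: crd_inj => v; rewrite crd_point /push_crd.
under eq_bigr do rewrite crd_point /push_crd.
transitivity (\sum_(x | g (f x) == v) crd t x).
  rewrite (partition_big f (fun w => g w == v)) //=.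
  apply: eq_bigr => w /eqP gw; apply: eq_bigl => x.
  by case: eqP => [->|]; rewrite ?gw ?eqxx ?andbF.
rewrite big_mkcond (bigD1 v) //= big1 => [|x xv].
  rewrite addr0; have [->|/gf ->] := eqVneq (crd t v) 0; last by rewrite eqxx.
  by case: ifP.
have [->|/gf ->] := eqVneq (crd t x) 0; first by case: ifP.
by rewrite (negbTE xv).
Qed.

Lemma flag_contiguity (V W : finType) (c : rel V) (d : rel W)
    (f : V -> W) (g : W -> V) :
  symmetric c -> symmetric d ->
  (forall x y, c x x -> c y y -> c x y -> d (f x) (f y)) ->
  (forall x y, d x x -> d y y -> d x y -> c (g x) (g y)) ->
  (forall x y, c x x -> c y y -> c x y -> c x (g (f y))) ->
  (forall x y, d x x -> d y y -> d x y -> d x (f (g y))) ->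
  homotopy_equiv R (flag_real R c) (flag_real R d).
Proof.
move=> csym dsym cd dc cgf dfg.
apply: (@straight_equiv _ _ _ _ (push cd) (push dc)).
- exact: push_continuous.
- exact: push_continuous.
- move=> t x y; have [_ _ tc] := crdP t.
  have E z : (crd (push dc (push cd t)) z != 0) || (crd t z != 0) ->
      exists2 v, z = g (f v) \/ z = v & crd t v != 0.
    case/orP => [/push_crd_neq0[w <- /push_crd_neq0[v <- tv]]|tz].
      by exists v => //; left.
    by exists z => //; right.
  move=> /E[v [->|->] tv] /E[w [->|->] tw].
  + by apply: (dc); apply: (cd); exact: tc.
  + by rewrite csym; apply: cgf; exact: tc.
  + by apply: cgf; exact: tc.
  + exact: tc.
- move=> t x y; have [_ _ td] := crdP t.
  have E z : (crd (push cd (push dc t)) z != 0) || (crd t z != 0) ->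
      exists2 v, z = f (g v) \/ z = v & crd t v != 0.
    case/orP => [/push_crd_neq0[w <- /push_crd_neq0[v <- tv]]|tz].
      by exists v => //; left.
    by exists z => //; right.
  move=> /E[v [->|->] tv] /E[w [->|->] tw].
  + by apply: (cd); apply: (dc); exact: td.
  + by rewrite dsym; apply: dfg; exact: td.
  + by apply: dfg; exact: td.
  + exact: td.
Qed.

Lemma eq_flag_equiv (V : finType) (c d : rel V) :
  (forall x y, c x x -> c y y -> c x y -> d x y) ->
  (forall x y, d x x -> d y y -> d x y -> c x y) ->
  homotopy_equiv R (flag_real R c) (flag_real R d).
Proof.
move=> cd dc; have -> : flag_real R c = flag_real R d.
  rewrite /flag_real; congr set_type; rewrite eqEsubset.
  by split => t [t0 t1 tc]; split => // x y tx ty; [apply: cd|apply: dc];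
    exact: tc.
by apply: (@homeomorphic_equiv _ _ _ id id) => // x; exact: cvg_id.
Qed.

Definition pair_rel (V : finType) (u v : V) : rel V :=
  fun x y => ((x == u) && (y == v)) || ((x == v) && (y == u)).

Section RemovePair.
Variables (V : finType) (c : rel V) (u v a : V).
Hypothesis csym : symmetric c.
Hypotheses (au : a != u) (av : a != v) (caa : c a a).
Hypothesis capex : forall y, c y y -> c u y -> c v y -> c a y.

Let c' : rel V := fun x y => c x y && ~~ pair_rel u v x y.

Let Iuv (w : V) : R := (w \in [set u; v]%SET)%:R.
Let N : R := #|[set u; v]%SET|%:R.

(* Moves the mass min (t u) (t v) off both u and v onto the apex a. *)
Let ret (t : V -> R) (w : V) : R :=
  let m := Num.min (t u) (t v) in t w - m * Iuv w + m * N * (w == a)%:R.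

Let Iuv_a : Iuv a = 0.
Proof. by rewrite /Iuv !inE (negbTE au) (negbTE av). Qed.

Let sum_Iuv : \sum_w Iuv w = N.
Proof.
rewrite /N -sum1_card natr_sum [RHS]big_mkcond /=.
by apply: eq_bigr => w _; rewrite /Iuv; case: ifP.
Qed.

Let retE t w : ret t w =
  t w - Num.min (t u) (t v) * Iuv w + Num.min (t u) (t v) * N * (w == a)%:R.
Proof. by []. Qed.

Let ret_neq0 (t : V -> R) w : (forall z, 0 <= t z) -> ret t w != 0 ->
  t w != 0 \/ [/\ w = a, t u != 0 & t v != 0].
Proof.
move=> t0; set m := Num.min (t u) (t v).
have m0 : 0 <= m by rewrite le_min !t0.
have [->|wa] := eqVneq w a.
  rewrite retE Iuv_a mulr0 subr0 -/m; have [->|mn] := eqVneq m 0.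
    by rewrite !mul0r addr0; left.
  have : 0 < m by rewrite lt_neqAle eq_sym mn.
  by rewrite lt_min => /andP[/lt0r_neq0 tu /lt0r_neq0 tv]; right.
rewrite retE (negbTE wa) mulr0 addr0 -/m => tw; left.
apply: contra_neq tw => tw.
rewrite tw sub0r; apply/eqP; rewrite oppr_eq0 mulf_eq0.
rewrite /Iuv !inE; have [wu|_] := eqVneq w u; rewrite /=.
  by rewrite oner_eq0 orbF eq_le m0 andbT /m ge_min -wu tw lexx.
have [wv|_] := eqVneq w v; rewrite /=; last by rewrite eqxx orbT.
by rewrite oner_eq0 orbF eq_le m0 andbT /m ge_min -wv tw lexx orbT.
Qed.

Let ret_compat (t : flag_real R c) x y :
  (ret (crd t) x != 0) || (crd t x != 0) ->
  (ret (crd t) y != 0) || (crd t y != 0) -> c x y.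
Proof.
have [t0 _ tc] := crdP t.
have E z : (ret (crd t) z != 0) || (crd t z != 0) ->
    crd t z != 0 \/ [/\ z = a, crd t u != 0 & crd t v != 0].
  by case/orP => [/ret_neq0|]; [exact|left].
have ta z : crd t z != 0 -> crd t u != 0 -> crd t v != 0 -> c a z.
  by move=> tz tu tv; apply: capex; exact: tc.
move=> /E[tx|[-> tu tv]] /E[ty|[-> tu' tv']] //.
- exact: tc.
- by rewrite csym; exact: ta.
- exact: ta.
Qed.

Let ret_subproof (t : flag_real R c) : flag_set R c' (ret (crd t)).
Proof.
have [t0 t1 tc] := crdP t.
split=> [w||x y].
- rewrite retE addr_ge0 ?mulr_ge0 ?ler0n ?le_min ?t0// subr_ge0 /Iuv !inE.
  case: eqVneq => [->|_] /=; first by rewrite mulr1 ge_min lexx.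
  case: eqVneq => [->|_] /=; first by rewrite mulr1 ge_min lexx orbT.
  by rewrite mulr0.
- under eq_bigr do rewrite retE.
  rewrite big_split sumrB -!mulr_sumr /= t1 sum_Iuv.
  have -> : \sum_i (i == a)%:R = 1 :> R.
    by rewrite (bigD1 a)//= eqxx big1 ?addr0// => i /negbTE ->.
  by rewrite mulr1 subrK.
- move=> rx ry; apply/andP; split.
    by apply: (@ret_compat t); rewrite ?rx ?ry.
  have : ret (crd t) u = 0 \/ ret (crd t) v = 0.
    rewrite !retE /Iuv !inE !eqxx orbT !mulr1 (eq_sym u a) (eq_sym v a).
    rewrite (negbTE au) (negbTE av) !mulr0 !addr0.
    by case: (leP (crd t u) (crd t v)) => _; rewrite subrr; [left|right].
  move=> r0; apply/negP => /orP[] /andP[/eqP xE /eqP yE]; subst x y;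
  by case: r0 => r0; move: rx ry; rewrite r0 eqxx.
Qed.

Let incl_subproof (t : flag_real R c') : flag_set R c (crd t).
Proof.
by have [t0 t1 tc] := crdP t; split => // x y tx ty; case/andP: (tc _ _ tx ty).
Qed.

Lemma remove_pair_equiv :
  homotopy_equiv R (flag_real R c) (flag_real R c').
Proof.
pose r t := flag_point (ret_subproof t).
pose i t := flag_point (incl_subproof t).
apply: (@straight_equiv _ _ _ _ r i).
- apply: continuous_into_flag => w.
  have cm : continuous (fun t : flag_real R c => Num.min (crd t u) (crd t v)).
    by apply: continuous_minr; exact: crd_continuous.
  apply: continuous_addr.
    apply: continuous_subr; first exact: crd_continuous.
    by apply: (continuous_mulr cm); exact: continuous_const.
  apply: continuous_mulr; last exact: continuous_const.
  by apply: (continuous_mulr cm); exact: continuous_const.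
- by apply: continuous_into_flag => w; exact: crd_continuous.
- by move=> t x y; exact: ret_compat.
- move=> t; have [t0 _ tc] := crdP t.
  have m0 : Num.min (crd t u) (crd t v) = 0.
    have [tu|tu] := eqVneq (crd t u) 0; first by rewrite tu min_l ?t0.
    have [tv|tv] := eqVneq (crd t v) 0; first by rewrite tv min_r ?t0.
    by have := tc _ _ tu tv; rewrite /c' /pair_rel !eqxx andbF.
  have E z : crd (r (i t)) z = crd t z.
    by rewrite crd_point retE crd_point m0 !mul0r subr0 addr0.
  by move=> x y; rewrite !E !orbb; exact: tc.
Qed.

End RemovePair.

(* [D] may be removed pair by pair because no apex lies on a pair of [D]
   that is compatible with the pair being removed. *)
Lemma remove_pairs_equiv (V : finType) (c D : rel V) :
  symmetric c -> symmetric D ->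
  (forall u v, D u v -> c u u -> c v v -> c u v ->
     exists a, forall y, y = a \/ [/\ c y y, c u y & c v y] ->
       c a y && ~~ D a y) ->
  homotopy_equiv R (flag_real R c)
    (flag_real R (fun x y => c x y && ~~ D x y)).
Proof.
pose DS (s : seq (V * V)) : rel V :=
  fun x y => ((x, y) \in s) || ((y, x) \in s).
suff H (s : seq (V * V)) : forall c, symmetric c ->
    (forall u v, DS s u v -> c u u -> c v v -> c u v ->
     exists a, forall y, y = a \/ [/\ c y y, c u y & c v y] ->
       c a y && ~~ DS s a y) ->
    homotopy_equiv R (flag_real R c)
      (flag_real R (fun x y => c x y && ~~ DS s x y)).
  move=> csym Dsym cD.
  have DE x y : DS (enum [pred p | D p.1 p.2]) x y = D x y.
    by rewrite /DS !mem_enum !inE /= (Dsym y) orbb.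
  have := H (enum [pred p | D p.1 p.2]) c csym.
  rewrite (_ : DS _ = D); last by apply/funext => x; apply/funext => y.
  exact.
elim: s => {c D} [|[u v] s IHs] c csym cD.
  by apply: eq_flag_equiv => x y _ _; rewrite /DS !inE /= andbT.
pose c' : rel V := fun x y => c x y && ~~ pair_rel u v x y.
have DE x y : DS ((u, v) :: s) x y = pair_rel u v x y || DS s x y.
  rewrite /DS /pair_rel !inE !xpair_eqE.
  by case: (x == u); case: (y == v); case: (x == v); case: (y == u);
    rewrite ?orbT.
have c'sym : symmetric c'.
  move=> x y; rewrite /c' csym /pair_rel.
  by rewrite orbC (andbC (x == v)) (andbC (x == u)).
have cc' : homotopy_equiv R (flag_real R c) (flag_real R c').
  have [/and3P[cu cv cuv]|ncuv] := boolP [&& c u u, c v v & c u v]; last first.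
    apply: eq_flag_equiv => [x y cx cy cxy|x y _ _ /andP[]//].
    rewrite /c' cxy; apply/negP => /orP[] /andP[/eqP xE /eqP yE]; subst x y.
      by rewrite cx cy cxy in ncuv.
    by rewrite cx cy (csym u) cxy in ncuv.
  have [||||a ca] := cD u v; rewrite ?DE /pair_rel ?eqxx //.
  have cuy y : [/\ c y y, c u y & c v y] -> c a y && ~~ DS ((u, v) :: s) a y.
    by move=> H; apply: ca; right.
  have {}ca := ca a (or_introl erefl).
  apply: (@remove_pair_equiv _ _ u v a) => //.
  - apply/eqP => au; have := cuy v; rewrite cv cuv => /(_ (And3 _ _ _)) H.
    by have /andP[_] := H isT isT isT; rewrite DE /pair_rel au !eqxx.
  - apply/eqP => av; have := cuy u.
    rewrite cu (csym v) cuv => /(_ (And3 _ _ _)) H.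
    by have /andP[_] := H isT isT isT; rewrite DE /pair_rel av !eqxx orbT.
  - by case/andP: ca.
  - by move=> y cy cuy' cvy; have /andP[] := cuy y (And3 cy cuy' cvy).
apply: homotopy_equiv_trans cc' _.
have -> : (fun x y => c x y && ~~ DS ((u, v) :: s) x y) =
          (fun x y => c' x y && ~~ DS s x y).
  by apply/funext => x; apply/funext => y; rewrite DE negb_or /c' andbA.
apply: IHs => // x y Dxy /andP[cx _] /andP[cy _] /andP[cxy _].
have [||||a ca] := cD x y; rewrite ?DE ?Dxy ?orbT //.
exists a => z cz.
have := ca z; rewrite DE negb_or /c' -!andbA; apply.
by case: cz => [->|[/andP[? _] /andP[? _] /andP[? _]]]; [left|right].
Qed.

End FlagReal.

(** * Cross-polytopes and spheres *)

Lemma continuous_into_row (R : realType) (X : topologicalType) (d : nat)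
    (f : X -> 'rV[R]_d) :
  (forall j, continuous (fun x => f x 0 j)) -> continuous f.
Proof.
move=> cf x; apply/cvg_ballP => e e0.
have H : \forall y \near x, forall j, ball (f x 0 j) e (f y 0 j).
  apply: filter_forall => j; have /cvg_ballP := cf j x.
  by move=> /(_ e e0).
near=> y; split => // i j; rewrite (ord1 i).
by move: j; near: y.
Unshelve. all: by end_near. Qed.

Definition cross_compat (d : nat) : rel ('I_d * bool) :=
  fun x y => (x.1 == y.1) ==> (x.2 == y.2).

Lemma cross_compat_sym d : symmetric (@cross_compat d).
Proof. by move=> x y; rewrite /cross_compat eq_sym (eq_sym x.2). Qed.

Section CrossPolytope.
Variables (R : realType) (d : nat).

Local Notation cross := (flag_real R (@cross_compat d.+1)).

Definition signed_crd (t : cross) (j : 'I_d.+1) : R :=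
  crd t (j, true) - crd t (j, false).

Definition sign_part (x : 'I_d.+1 -> R) (p : 'I_d.+1 * bool) : R :=
  Num.max 0 (if p.2 then x p.1 else - x p.1).

Definition sqnorm (x : 'I_d.+1 -> R) : R := \sum_j x j ^+ 2.

Definition norm1 (x : 'I_d.+1 -> R) : R := \sum_p sign_part x p.

Lemma sign_part_ge0 x p : 0 <= sign_part x p.
Proof. by rewrite /sign_part le_max lexx. Qed.

Lemma sign_partB x j : sign_part x (j, true) - sign_part x (j, false) = x j.
Proof.
rewrite /sign_part /=; have [x0|x0] := leP 0 (x j).
  by rewrite (max_l (_ : - x j <= 0)) ?oppr_le0// subr0.
by rewrite max_r ?oppr_ge0 ?ltW// sub0r opprK.
Qed.

Lemma sign_partZ (k : R) x p : 0 <= k ->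
  sign_part (fun j => k * x j) p = k * sign_part x p.
Proof. by move=> k0; rewrite /sign_part -mulrN -fun_if maxr_pMr// mulr0. Qed.

Lemma norm1Z (k : R) x : 0 <= k -> norm1 (fun j => k * x j) = k * norm1 x.
Proof.
move=> k0; rewrite /norm1 mulr_sumr; apply: eq_bigr => p _.
exact: sign_partZ.
Qed.

Lemma sqnormZ (k : R) x : sqnorm (fun j => k * x j) = k ^+ 2 * sqnorm x.
Proof. by rewrite /sqnorm mulr_sumr; under eq_bigr do rewrite exprMn. Qed.

Lemma sqnorm_ge0 x : 0 <= sqnorm x.
Proof. by apply: sumr_ge0 => j _; exact: sqr_ge0. Qed.

Lemma norm1_gt0 x : sqnorm x != 0 -> 0 < norm1 x.
Proof.
move=> x0; rewrite lt_neqAle sumr_ge0 ?andbT; last first.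
  by move=> p _; exact: sign_part_ge0.
rewrite eq_sym; apply: contra_neq x0 => /eqP.
rewrite psumr_eq0 => [/allP s0|p _]; last exact: sign_part_ge0.
apply: big1 => j _.
have s0' p : sign_part x p = 0 by apply/eqP/(implyP (s0 p (mem_index_enum p))).
by rewrite -(sign_partB x j) !s0' subrr expr0n.
Qed.

Lemma sign_part_signed (t : cross) p : sign_part (signed_crd t) p = crd t p.
Proof.
have [t0 _ tc] := crdP t; case: p => j b; rewrite /sign_part /signed_crd /=.
have [tj|tj] := eqVneq (crd t (j, true)) 0.
  by case: b; rewrite tj sub0r ?opprK; [rewrite max_l ?oppr_le0|rewrite max_r].
have [tf|tf] := eqVneq (crd t (j, false)) 0.
  by case: b; rewrite tf subr0; [rewrite max_r|rewrite max_l ?oppr_le0].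
by have := tc _ _ tj tf; rewrite /cross_compat /= eqxx.
Qed.

Lemma norm1_signed (t : cross) : norm1 (signed_crd t) = 1.
Proof.
have [_ <- _] := crdP t; apply: eq_bigr => p _; exact: sign_part_signed.
Qed.

Lemma sqnorm_signed_gt0 (t : cross) : 0 < sqnorm (signed_crd t).
Proof.
rewrite lt_neqAle sqnorm_ge0 andbT eq_sym; apply/eqP => s0.
have /eqP := norm1_signed t; rewrite /norm1 big1 ?(eq_sym 0) ?oner_eq0// => p _.
have sj j : signed_crd t j = 0.
  move/eqP: s0; rewrite psumr_eq0.
    move=> /allP/(_ j (mem_index_enum j))/implyP.
    by move=> /(_ isT); rewrite sqrf_eq0 => /eqP.
  by move=> i _; exact: sqr_ge0.
by rewrite /sign_part sj oppr0 if_same maxxx.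
Qed.

Let sphere_row (t : cross) : 'rV[R]_d.+1 :=
  \row_j ((Num.sqrt (sqnorm (signed_crd t)))^-1 * signed_crd t j).

Let sphere_rowP t : sphere_set R d (sphere_row t).
Proof.
rewrite /sphere_set /=; under eq_bigr do rewrite mxE.
rewrite -/(sqnorm (fun j => _ * signed_crd t j)) sqnormZ exprVn sqr_sqrtr.
  by rewrite mulVf// gt_eqF// sqnorm_signed_gt0.
exact: sqnorm_ge0.
Qed.

Definition cross_to_sphere (t : cross) : sphere R d :=
  exist (fun x => x \in sphere_set R d) _ (mem_set (sphere_rowP t)).

Definition sphere_crd (y : sphere R d) (j : 'I_d.+1) : R :=
  (set_val y : 'rV[R]_d.+1) 0 j.

Lemma sphere_sqnorm y : sqnorm (sphere_crd y) = 1.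
Proof. exact: (set_valP y). Qed.

Let cross_crd (y : sphere R d) p : R :=
  sign_part (sphere_crd y) p / norm1 (sphere_crd y).

Let sphere_norm1_gt0 y : 0 < norm1 (sphere_crd y).
Proof. by rewrite norm1_gt0// sphere_sqnorm oner_eq0. Qed.

Let cross_crdP y : flag_set R (@cross_compat d.+1) (cross_crd y).
Proof.
split=> [p||[i a] [j b]].
- by rewrite divr_ge0 ?sign_part_ge0 ?ltW ?sphere_norm1_gt0.
- by rewrite -mulr_suml divff// gt_eqF ?sphere_norm1_gt0.
rewrite !mulf_eq0 !negb_or => /andP[xa _] /andP[xb _].
rewrite /cross_compat /=; apply/implyP => /eqP ij; subst j; move: xa xb.
rewrite /sign_part /=.
case: a b => [] [] //; have [x0|x0] := leP 0 (sphere_crd y i).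
- by rewrite (max_l (_ : - _ <= 0)) ?eqxx ?oppr_le0.
- by rewrite eqxx.
- by rewrite (max_l (_ : - _ <= 0)) ?eqxx ?oppr_le0.
- by rewrite eqxx.
Qed.

Definition sphere_to_cross (y : sphere R d) : cross :=
  flag_point (cross_crdP y).

Lemma cross_to_sphereK : cancel cross_to_sphere sphere_to_cross.
Proof.
move=> t; apply: crd_inj => p; rewrite crd_point /cross_crd.
set k := (Num.sqrt (sqnorm (signed_crd t)))^-1.
have k0 : 0 < k by rewrite invr_gt0 sqrtr_gt0 sqnorm_signed_gt0.
have -> : sphere_crd (cross_to_sphere t) = fun j => k * signed_crd t j.
  by apply/funext => j; rewrite /sphere_crd mxE.
rewrite sign_partZ ?norm1Z ?(ltW k0)// norm1_signed mulr1 sign_part_signed.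
by rewrite mulrC mulKf// gt_eqF.
Qed.

Lemma sphere_to_crossK : cancel sphere_to_cross cross_to_sphere.
Proof.
move=> y; apply: val_inj; apply/rowP => j; rewrite mxE.
set N := norm1 (sphere_crd y).
have N0 : 0 < N by exact: sphere_norm1_gt0.
have -> : signed_crd (sphere_to_cross y) = fun j => N^-1 * sphere_crd y j.
  apply/funext => i; rewrite /signed_crd !crd_point /cross_crd -mulrBl.
  by rewrite sign_partB mulrC.
rewrite sqnormZ sphere_sqnorm mulr1 sqrtr_sqr gtr0_norm ?invr_gt0//.
by rewrite invrK mulVKf ?gt_eqF.
Qed.

Lemma cross_to_sphere_continuous : continuous cross_to_sphere.
Proof.
apply: continuous_into_set_type; apply: continuous_into_row => j.
have cs i : continuous (fun t => signed_crd t i).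
  by apply: continuous_subr; exact: crd_continuous.
rewrite (_ : (fun t => _) = fun t =>
    signed_crd t j / Num.sqrt (sqnorm (signed_crd t))); last first.
  by apply/funext => t; rewrite mxE mulrC.
apply: continuous_divr => // [|t]; last first.
  by rewrite gt_eqF// sqrtr_gt0 sqnorm_signed_gt0.
apply: (@continuous_compose _ _ _ (fun t => sqnorm (signed_crd t)) Num.sqrt).
  apply: continuous_sumr => i _; under eq_fun do rewrite expr2.
  exact: continuous_mulr.
exact: sqrt_continuous.
Qed.

Lemma sphere_to_cross_continuous : continuous sphere_to_cross.
Proof.
have cy j : continuous (fun y => sphere_crd y j).
  apply: (@continuous_compose _ _ _ set_val (fun x : 'rV[R]_d.+1 => x 0 j)).
    exact: continuous_set_val.
  exact: coord_continuous.
have cp p : continuous (fun y => sign_part (sphere_crd y) p).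
  apply: continuous_maxr; first exact: continuous_const.
  case: p => j [] /=; first exact: cy.
  under eq_fun do rewrite -sub0r; apply: continuous_subr => //.
  exact: continuous_const.
apply: continuous_into_flag => p; apply: continuous_divr => // [|y].
  exact: continuous_sumr.
by rewrite gt_eqF ?sphere_norm1_gt0.
Qed.

Lemma cross_sphere_equiv : homotopy_equiv R cross (sphere R d).
Proof.
apply: homeomorphic_equiv cross_to_sphereK sphere_to_crossK.
- exact: cross_to_sphere_continuous.
- exact: sphere_to_cross_continuous.
Qed.

Lemma crd_sphere_point p :
  crd (sphere_to_cross (sphere_point R d)) p = (p == (ord0, true))%:R.
Proof.
have sE q :
    sign_part (sphere_crd (sphere_point R d)) q = (q == (ord0, true))%:R.
  case: q => j b; rewrite /sign_part /sphere_crd set_valE /= mxE eqxx /=.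
  rewrite xpair_eqE; case: b; rewrite ?andbT ?andbF; last first.
    by rewrite max_l// oppr_le0 ler0n.
  by rewrite max_r// ler0n.
rewrite crd_point /cross_crd /norm1; under eq_bigr do rewrite sE.
rewrite sE (bigD1 (ord0, true))//= big1 => [|q /negbTE -> //].
by rewrite addr0 divr1.
Qed.

End CrossPolytope.

(** * Bouquets of cross-polytopes and wedges of spheres *)

(* Vertices of [q] cross-polytopes sharing a pole: [None] is the shared pole,
   [Some (i, None)] the opposite pole of the [i]-th one, and
   [Some (i, Some (j, b))] the vertices of its equator. *)
Definition bouquet_vertex (q d : nat) : finType :=
  option ('I_q * option ('I_d * bool)).

Definition bouquet_compat (q d : nat) : rel (bouquet_vertex q d) :=
  fun x y => match x, y with
  | None, None => true
  | None, Some (_, z) | Some (_, z), None => z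
  | Some (i, z), Some (i', z') => (i == i') &&
      match z, z' with
      | Some u, Some v => cross_compat u v
      | _, _ => true
      end
  end.

Section Bouquet.
Variables (R : realType) (q d : nat).

Local Notation bouquet := (flag_real R (@bouquet_compat q.+1 d)).
Local Notation cross := (flag_real R (@cross_compat d.+1)).
Local Notation wedge_of_spheres := (sphere_wedge R q.+1 d).

Definition petal (i : 'I_q.+1) (p : 'I_d.+1 * bool) : bouquet_vertex q.+1 d :=
  match unlift ord0 p.1 with
  | None => if p.2 then None else Some (i, None)
  | Some j => Some (i, Some (j, p.2))
  end.

Definition to_petal (i : 'I_q.+1) (x : bouquet_vertex q.+1 d) :
    'I_d.+1 * bool :=
  match x with
  | None => (ord0, true)
  | Some (i', z) => if i' == i then
      match z with None => (ord0, false) | Some (j, b) => (lift ord0 j, b) end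
      else (ord0, true)
  end.

Lemma petalK i : cancel (petal i) (to_petal i).
Proof.
move=> [j b]; rewrite /petal /=; case: unliftP => [k ->|->] /=.
  by rewrite eqxx.
by case: b; rewrite //= eqxx.
Qed.

Lemma petal_compat i x y : cross_compat x x -> cross_compat y y ->
  cross_compat x y -> bouquet_compat (petal i x) (petal i y).
Proof.
move=> _ _; case: x => [j a]; case: y => [k b]; rewrite /petal /cross_compat /=.
case: unliftP => [j' ->|->]; case: unliftP => [k' ->|->] //=.
- by rewrite eqxx (inj_eq (@lift_inj _ ord0)).
- by case: b; rewrite //= eqxx.
- by case: a; rewrite //= eqxx.
- by case: a; case: b; rewrite //= ?eqxx.
Qed.

Lemma to_petal_compat i x y : bouquet_compat x x -> bouquet_compat y y ->
  bouquet_compat x y -> cross_compat (to_petal i x) (to_petal i y).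
Proof.
move=> _ _; case: x => [[i1 [[j a]|]]|]; case: y => [[i2 [[k b]|]]|] //=;
  rewrite /cross_compat /=; try (by case: (_ == i));
  by case/andP => /eqP -> /=; case: (i2 == i).
Qed.

Let incl i : cross -> bouquet := push (petal_compat i).
Let proj i : bouquet -> cross := push (@to_petal_compat i).

Let in_petal i (x : bouquet_vertex q.+1 d) : bool :=
  if x is Some (i', _) then i' == i else true.

Let to_petalK i x : in_petal i x -> petal i (to_petal i x) = x.
Proof.
case: x => [[i' [[j b]|]]|] /=; rewrite /petal ?unlift_none //.
  by move=> /eqP ->; rewrite eqxx /= liftK.
by move=> /eqP ->; rewrite eqxx /= unlift_none.
Qed.

Let inclK i : cancel (incl i) (proj i).
Proof. by move=> t; apply: pushK => v _; exact: petalK. Qed.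

Let in_petal_set i : set bouquet :=
  [set t | \sum_(x | ~~ in_petal i x) crd t x = 0].

Let in_petal_setP i t :
  in_petal_set i t <-> forall x, ~~ in_petal i x -> crd t x = 0.
Proof.
have [t0 _ _] := crdP t; split => [/eqP|t0']; last exact: big1.
rewrite psumr_eq0 => [/allP h x xi|//].
by apply/eqP/(implyP (h x (mem_index_enum x))).
Qed.

Let closed_in_petal i : closed (in_petal_set i).
Proof.
apply: (@closed_comp _ _ (fun t : bouquet => \sum_(x | ~~ in_petal i x) crd t x)
  [set 0]).
  by move=> t _; apply: continuous_sumr => x _; exact: crd_continuous.
exact: closed_eq.
Qed.

Let projK i t : in_petal_set i t -> incl i (proj i t) = t.
Proof.
move/in_petal_setP => ti; apply: pushK => v tv; apply: to_petalK.
by apply: contraNT tv => /ti ->.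
Qed.

Let incl_in_petal i s : in_petal_set i (incl i s).
Proof.
apply/in_petal_setP => x; apply: contraNeq => /push_crd_neq0[[j b] <- _].
rewrite /petal /=; case: unliftP => [k _|_] /=; first by rewrite eqxx.
by case: b; rewrite //= eqxx.
Qed.

Let pole : cross := sphere_to_cross (sphere_point R d).

Let incl_pole i x : crd (incl i pole) x = (x == None)%:R.
Proof.
rewrite crd_point /push_crd; under eq_bigr do rewrite crd_sphere_point.
have pE : petal i (ord0, true) = None by rewrite /petal unlift_none.
rewrite big_mkcond (bigD1 (ord0, true)) //= pE big1 => [|p pn].
  by rewrite addr0 eq_sym; case: eqP.
by rewrite (negbTE pn) if_same.
Qed.

Let proj_pole i j t : in_petal_set i t -> in_petal_set j t -> i != j ->
  proj i t = pole.
Proof.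
move=> /in_petal_setP ti /in_petal_setP tj ij.
rewrite -[LHS](inclK i) -[RHS](inclK i); congr (proj i _).
rewrite projK; last exact/in_petal_setP.
have [_ t1 _] := crdP t.
have tS p : crd t (Some p) = 0.
  case: p => k z; have [ki|ki] := eqVneq k i; last exact: ti.
  by apply: tj; rewrite /= ki.
apply: crd_inj => x; rewrite incl_pole; case: x => [p|] /=; first exact: tS.
by rewrite -t1 (bigD1 None) //= big1 ?addr0// => -[p|].
Qed.

Let petal_lift i (y : sphere R d) : wedge_of_spheres :=
  @wedge_lift 'I_q.+1 (fun=> sphere R d) (fun=> sphere_point R d) i y.

Let lift_of i (t : bouquet) : wedge_of_spheres :=
  petal_lift i (cross_to_sphere (proj i t)).

Let lift_of_eq i j t : in_petal_set i t -> in_petal_set j t ->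
  lift_of i t = lift_of j t.
Proof.
move=> ti tj; have [->//|ij] := eqVneq i j.
rewrite /lift_of (proj_pole ti tj ij) (proj_pole tj ti) 1?eq_sym//.
rewrite /pole sphere_to_crossK; rewrite /petal_lift.
exact: (@wedge_liftE _ _ (fun=> sphere_point R d) j (sphere_point R d)
  i (sphere_point R d)).
Qed.

Let in_some_petal t : exists i, in_petal_set i t.
Proof.
have [_ _ tc] := crdP t.
have [/existsP[[i z] tz]|/existsPn t0] := boolP [exists p, crd t (Some p) != 0].
  exists i; apply/in_petal_setP => -[[k w]|] //= ki.
  apply/eqP; apply: contraNT ki => tw.
  by have := tc _ _ tw tz; case/andP.
exists ord0; apply/in_petal_setP => -[p|] //= _.
by apply/eqP; move/negPn: (t0 p).
Qed.

Let petal_of t : 'I_q.+1 := projT1 (cid (in_some_petal t)).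

Let petal_ofP t : in_petal_set (petal_of t) t.
Proof. exact: (projT2 (cid (in_some_petal t))). Qed.

Let to_wedge t : wedge_of_spheres := lift_of (petal_of t) t.

Let to_wedgeE i t : in_petal_set i t -> to_wedge t = lift_of i t.
Proof. by move=> ti; apply: lift_of_eq => //; exact: petal_ofP. Qed.

Let to_wedge_continuous : continuous to_wedge.
Proof.
have cl i : continuous (lift_of i).
  apply: (@continuous_compose _ _ _ (fun t => cross_to_sphere (proj i t))
    (petal_lift i)); last first.
    exact: (@wedge_lift_continuous _ (fun=> sphere R d)
      (fun=> sphere_point R d) i).
  apply: (@continuous_compose _ _ _ (proj i) (@cross_to_sphere R d)).
    exact: push_continuous.
  exact: cross_to_sphere_continuous.
apply/continuous_closedP => C cC.
have -> : to_wedge @^-1` C =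
    \bigcup_(i in [set: 'I_q.+1]) (in_petal_set i `&` lift_of i @^-1` C).
  rewrite eqEsubset; split => t /=.
    by move=> tC; exists (petal_of t) => //; split => //; exact: petal_ofP.
  by case=> i _ [ti tC]; rewrite /= (to_wedgeE ti).
apply: closed_bigcup; first exact: finite_finset.
move=> i _; apply: closedI; first exact: closed_in_petal.
by move/continuous_closedP: (@cl i); exact.
Qed.

Let from_wedge : wedge_of_spheres -> bouquet :=
  wedge_fun (fun i (y : sphere R d) => incl i (sphere_to_cross y)).

Let from_wedge_agree i j :
  incl i (sphere_to_cross (sphere_point R d)) =
  incl j (sphere_to_cross (sphere_point R d)).
Proof. by apply: crd_inj => x; rewrite !incl_pole. Qed.

Lemma bouquet_equiv : homotopy_equiv R bouquet wedge_of_spheres.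
Proof.
apply: (@homeomorphic_equiv _ _ _ to_wedge from_wedge) => //.
- apply: wedge_fun_continuous => [i|i j]; last exact: from_wedge_agree.
  apply: (@continuous_compose _ _ _ (@sphere_to_cross R d) (incl i)).
    exact: sphere_to_cross_continuous.
  exact: push_continuous.
- move=> t; rewrite /to_wedge /from_wedge /lift_of /petal_lift.
  rewrite wedge_lift_funE; last exact: from_wedge_agree.
  by rewrite cross_to_sphereK projK//; exact: petal_ofP.
- move=> w; have : [set: wedge_of_spheres] w by [].
  rewrite -wedgeTE => -[i _ [y _ <-]].
  rewrite /from_wedge wedge_lift_funE; last exact: from_wedge_agree.
  rewrite (@to_wedgeE i); last exact: incl_in_petal.
  by rewrite /lift_of inclK sphere_to_crossK.
Qed.

End Bouquet.

Definition join_compat (d q : nat) : rel ('I_d * bool + 'I_q) :=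
  fun x y => match x, y with
  | inl u, inl v => cross_compat u v
  | inr i, inr j => i == j
  | _, _ => true
  end.

Lemma join_compat_sym d q : symmetric (@join_compat d q).
Proof.
by move=> [u|i] [v|j] //=; exact: cross_compat_sym.
Qed.

(* The join of {p_0, ..., p_q} with the equator, each equatorial vertex being
   replaced by q mutually compatible twins, one for each cross-polytope of the
   bouquet. *)
Definition thick_compat (q d : nat) : rel (bouquet_vertex q d) :=
  fun x y => match x, y with
  | Some (_, Some u), Some (_, Some v) => cross_compat u v
  | Some (_, Some _), _ | _, Some (_, Some _) => true
  | _, _ => x == y
  end.

Lemma thick_compat_sym q d : symmetric (@thick_compat q d).
Proof.
by move=> [[i [u|]]|] [[j [v|]]|] //=; exact: cross_compat_sym.
Qed.

Definition pole_cut (q d : nat) : rel (bouquet_vertex q d) :=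
  fun x y => match x, y with
  | Some (i, None), Some (j, Some _)
  | Some (i, Some _), Some (j, None) => i != j
  | _, _ => false
  end.

Lemma pole_cut_sym q d : symmetric (@pole_cut q d).
Proof. by move=> [[i [u|]]|] [[j [v|]]|] //=; rewrite eq_sym. Qed.

Definition equator_cut (q d : nat) : rel (bouquet_vertex q d) :=
  fun x y => match x, y with
  | Some (i, Some _), Some (j, Some _) => i != j
  | _, _ => false
  end.

Lemma equator_cut_sym q d : symmetric (@equator_cut q d).
Proof. by move=> [[i [u|]]|] [[j [v|]]|] //=; rewrite eq_sym. Qed.

Section JoinBouquet.
Variables (R : realType) (q d : nat).

Let vertex := bouquet_vertex q.+1 d.

Let thicken (x : 'I_d * bool + 'I_q.+2) : vertex :=
  match x with
  | inl u => Some (ord0, Some u)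
  | inr k => if unlift ord0 k is Some i then Some (i, None) else None
  end.

Let thin (x : vertex) : 'I_d * bool + 'I_q.+2 :=
  match x with
  | None => inr ord0
  | Some (i, None) => inr (lift ord0 i)
  | Some (_, Some u) => inl u
  end.

Lemma join_thick_equiv :
  homotopy_equiv R (flag_real R (@join_compat d q.+2))
                   (flag_real R (@thick_compat q.+1 d)).
Proof.
have thickenK x : thin (thicken x) = x.
  by case: x => [//|k] /=; case: unliftP => [i ->|->].
apply: (@flag_contiguity _ _ _ _ _ thicken thin).
- exact: join_compat_sym.
- exact: thick_compat_sym.
- move=> [u|k] [v|l] _ _ //=; first by case: unliftP.
    by case: unliftP.
  by move=> /eqP ->; case: unliftP => //=.
- move=> [[i [u|]]|] [[j [v|]]|] _ _ //=.
  by move=> /eqP[->].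
- by move=> x y _ _; rewrite thickenK.
- move=> [[i [u|]]|] [[j [v|]]|] _ _ //=; rewrite ?unlift_none ?liftK //.
Qed.

Lemma join_bouquet_equiv :
  homotopy_equiv R (flag_real R (@join_compat d q.+2))
                   (flag_real R (@bouquet_compat q.+1 d)).
Proof.
apply: homotopy_equiv_trans join_thick_equiv _.
apply: homotopy_equiv_trans.
  apply: (@remove_pairs_equiv _ _ _ (@pole_cut q.+1 d)).
  - exact: thick_compat_sym.
  - exact: pole_cut_sym.
  suff H i j u : i != j ->
      exists a : vertex, forall y, y = a \/
        [/\ thick_compat y y, thick_compat (Some (i, None)) y
          & thick_compat (Some (j, Some u)) y] ->
      thick_compat a y && ~~ pole_cut a y.
    move=> [[i [u|]]|] [[j [v|]]|] // ij _ _ _; last exact: (H i j v ij).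
    have [|a aP] := H j i u; first by rewrite eq_sym.
    by exists a => y [->|[? ? ?]]; apply: aP; [left|right].
  move=> ij; exists (Some (i, Some u)) => y [->|[]].
    by rewrite /= andbT /cross_compat !eqxx.
  case: y => [[k [w|]]|] //= _; first by move=> _ ->.
  by move=> /eqP[->]; rewrite eqxx.
apply: homotopy_equiv_trans.
  apply: (@remove_pairs_equiv _ _ _ (@equator_cut q.+1 d)).
  - by move=> x y; rewrite thick_compat_sym pole_cut_sym.
  - exact: equator_cut_sym.
  move=> [[i [u|]]|] [[j [v|]]|] //= ij _ _ _.
  exists None => y [->//|[]]; case: y => [[k [w|]]|] //= _.
  by rewrite !negbK => /eqP <- /eqP ji; rewrite ji eqxx in ij.
apply: eq_flag_equiv => -[[i [u|]]|] [[j [v|]]|] //= _ _;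
  rewrite ?andbT ?negbK //.
- by rewrite andbC.
- by move=> /eqP[->]; rewrite eqxx.
- by rewrite andbC.
- by move=> /eqP ->; rewrite eqxx.
Qed.

Lemma join_wedge_equiv :
  homotopy_equiv R (flag_real R (@join_compat d q.+2)) (sphere_wedge R q.+1 d).
Proof.
exact: homotopy_equiv_trans join_bouquet_equiv (bouquet_equiv R q d).
Qed.

End JoinBouquet.

Local Close Scope ring_scope.
Local Close Scope classical_set_scope.
Local Open Scope nat_scope.

(** * Edge moves on graphs with numbered vertices *)

(* Graphs on the labels {0, ..., N-1}: a loop marks an absent vertex. *)
Definition linked (e : rel nat) : rel nat := fun x y => e x y || e y x.

Definition label_compat (N : nat) (e : rel nat) : rel 'I_N :=
  fun x y => ~~ linked e x y.

Lemma linked_sym e : symmetric (linked e).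
Proof. by move=> x y; rewrite /linked orbC. Qed.

Lemma label_compat_sym N e : symmetric (@label_compat N e).
Proof. by move=> x y; rewrite /label_compat linked_sym. Qed.

Section LabelMoves.
Variables (R : realType) (N : nat).
Implicit Types e d : rel nat.

Lemma eq_label_equiv e d :
  (forall x y, x < N -> y < N -> e x y -> [|| linked d x y, d x x | d y y]) ->
  (forall x y, x < N -> y < N -> d x y -> [|| linked e x y, e x x | e y y]) ->
  homotopy_equiv R (flag_real R (@label_compat N e))
                   (flag_real R (@label_compat N d)).
Proof.
move=> ed de; apply: eq_flag_equiv => x y;
  rewrite /label_compat {1 2}/linked !orbb => /negPf nx /negPf ny;
  apply: contra => /orP[H|H].
- by have := de _ _ (ltn_ord x) (ltn_ord y) H; rewrite nx ny !orbF.
- have := de _ _ (ltn_ord y) (ltn_ord x) H; rewrite nx ny !orbF.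
  by rewrite linked_sym.
- by have := ed _ _ (ltn_ord x) (ltn_ord y) H; rewrite nx ny !orbF.
- have := ed _ _ (ltn_ord y) (ltn_ord x) H; rewrite nx ny !orbF.
  by rewrite linked_sym.
Qed.

Lemma add_edges_equiv e d :
  (forall u v, u < N -> v < N -> d u v ->
     exists a, [/\ a < N, ~~ (e a a || d a a)
       & forall y, y < N -> linked e a y || linked d a y ->
           linked e u y || linked e v y]) ->
  homotopy_equiv R (flag_real R (@label_compat N e))
    (flag_real R (@label_compat N (fun x y => e x y || d x y))).
Proof.
move=> H; pose D : rel 'I_N := fun x y => linked d x y.
have -> : label_compat (fun x y => e x y || d x y) =
    (fun x y : 'I_N => label_compat e x y && ~~ D x y).
  apply/funext => x; apply/funext => y; rewrite /label_compat /D /linked.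
  by rewrite -negb_or orbACA.
apply: remove_pairs_equiv.
- exact: label_compat_sym.
- by move=> x y; rewrite /D linked_sym.
have {}H (u v : 'I_N) : d u v -> exists a : 'I_N, forall y, y = a \/
    [/\ label_compat e y y, label_compat e u y & label_compat e v y] ->
    label_compat e a y && ~~ D a y.
  move=> /(H _ _ (ltn_ord u) (ltn_ord v))[a [aN na ay]].
  exists (Ordinal aN) => y.
  rewrite /label_compat /D -negb_or => -[->|[_ nu nv]].
    by rewrite /linked !orbb.
  by apply: contra (ay _ (ltn_ord y)) _; rewrite negb_or nu nv.
move=> u v /orP[/H[a Ha]|/H[a Ha]] _ _ _; exists a => y Hy; apply: Ha => //.
by case: Hy => [->|[? ? ?]]; [left|right].
Qed.

End LabelMoves.

(* [lia] is too slow on the disjunctions defining the edges as a whole. *)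
Ltac some_clause :=
  lazymatch goal with
  | |- is_true (_ || _) =>
      apply/orP; first [left; some_clause|right; some_clause]
  | _ => lia
  end.

Ltac each_clause_with tac :=
  lazymatch goal with
  | |- is_true (_ || _) -> _ => case/orP; each_clause_with tac
  | |- _ => let H := fresh in move=> H;
      first [exfalso; lia | some_clause
            | tac; first [exfalso; lia | some_clause]]
  end.

Ltac each_clause := each_clause_with fail.

Ltac no_clause := apply/negP; red; each_clause.

(* The cycle on {0, ..., m-1} after j steps: the cycle 0, 3j+1, ..., m-1 and the
   isolated edges (3i+1, 3i+2), i < j, and (m, m+1). *)
Definition cycle_edge (m j : nat) : rel nat := fun x y =>
  [|| (x == 0) && (y == 3 * j + 1),
      [&& 3 * j + 1 <= x, y == x + 1 & y < m],
      (x == 0) && (y == m - 1),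
      [&& y <= 3 * j, x %% 3 == 1 & y == x + 1],
      [&& x == y, 0 < x, x <= 3 * j & x %% 3 == 0]
    | (x == m) && (y == m + 1)].

Lemma cycle_step (R : realType) (m j : nat) : 3 * j + 5 <= m ->
  homotopy_equiv R (flag_real R (@label_compat (m + 2) (cycle_edge m j)))
                   (flag_real R (@label_compat (m + 2) (cycle_edge m j.+1))).
Proof.
move=> jm.
pose d1 : rel nat := fun x y => (x == 0) && (y == 3 * j + 4).
pose d2 : rel nat := fun x y => (x == 0) && (y == 3 * j + 1).
pose d3 : rel nat := fun x y => (x == 3 * j + 3) && (y == 3 * j + 3).
pose e : rel nat := fun x y =>
  [|| (x == 0) && (y == 3 * j + 4),
      [&& 3 * j + 1 <= x, y == x + 1 & y < m],
      (x == 0) && (y == m - 1),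
      [&& y <= 3 * j, x %% 3 == 1 & y == x + 1],
      [&& x == y, 0 < x, x <= 3 * j & x %% 3 == 0]
    | (x == m) && (y == m + 1)].
apply: homotopy_equiv_trans.
  apply: (@add_edges_equiv R _ _ d1) => u v _ _ /andP[/eqP -> /eqP ->].
  exists (3 * j + 2); split; [lia|rewrite /cycle_edge /d1; no_clause|].
  move=> y _; rewrite /linked /cycle_edge /d1; each_clause.
apply: homotopy_equiv_trans.
  apply: (@eq_label_equiv R _ _ (fun x y => e x y || d2 x y)) => x y _ _;
  rewrite /linked /e /d2 /d1 /cycle_edge; each_clause.
apply: homotopy_equiv_trans.
  apply: homotopy_equiv_sym.
  apply: (@add_edges_equiv R _ e d2) => u v _ _ /andP[/eqP -> /eqP ->].
  exists (3 * j + 3); split; [lia|rewrite /e /d2; no_clause|].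
  move=> y _; rewrite /linked /e /d2; each_clause.
apply: homotopy_equiv_trans.
  apply: (@add_edges_equiv R _ _ d3) => u v _ _ /andP[/eqP -> /eqP ->].
  exists (3 * j + 1); split; [lia|rewrite /e /d3; no_clause|].
  move=> y _; rewrite /linked /e /d3; each_clause.
apply: eq_label_equiv => x y _ _; rewrite /linked /e /d3 /cycle_edge;
  each_clause_with ltac:(case: (leqP x (3 * j)) => ?;
    case: (leqP x (3 * j + 1)) => ?;
    case: (leqP x (3 * j + 2)) => ?; case: (leqP x (3 * j + 3)) => ?).
Qed.

(* The rungs are (i, i+m). After j steps rung 0 is followed by rung 2j+1,
   with a twist when j is odd; the rungs 2i+1 and 2i+2, i < j, are replaced by
   the isolated edge (2i+1, 2i+2). For j = 0 this is the graph DC together with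
   the isolated edge (2m, 2m+1). *)
Definition ladder_edge (m j : nat) : rel nat := fun x y =>
  [|| (x == 0) && (y == m),
      [&& 2 * j + 1 <= x, x < m & y == x + m],
      [&& 2 * j + 1 <= x, y == x + 1 & y < m],
      [&& m + 2 * j + 1 <= x, y == x + 1 & y < 2 * m],
      (x == m - 1) && (y == m),
      (x == 0) && (y == 2 * m - 1),
      [&& j %% 2 == 0, x == 0 & y == 2 * j + 1],
      [&& j %% 2 == 0, x == m & y == m + 2 * j + 1],
      [&& j %% 2 == 1, x == 0 & y == m + 2 * j + 1],
      [&& j %% 2 == 1, x == 2 * j + 1 & y == m],
      [&& x %% 2 == 1, x < 2 * j & y == x + 1],
      [&& x == y, m < x & x <= m + 2 * j]
    | (x == 2 * m) && (y == 2 * m + 1)].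

Lemma ladder_step (R : realType) (m j : nat) : 2 * j + 4 <= m ->
  homotopy_equiv R (flag_real R (@label_compat (2 * m + 2) (ladder_edge m j)))
    (flag_real R (@label_compat (2 * m + 2) (ladder_edge m j.+1))).
Proof.
move=> jm.
pose d1 : rel nat := fun x y =>
  [|| [&& j %% 2 == 1, x == 0 & y == 2 * j + 3],
      [&& j %% 2 == 1, x == m & y == m + 2 * j + 3],
      [&& j %% 2 == 0, x == 0 & y == m + 2 * j + 3]
    | [&& j %% 2 == 0, x == 2 * j + 3 & y == m]].
pose d2 : rel nat := fun x y =>
  [|| [&& j %% 2 == 0, x == 0 & y == 2 * j + 1],
      [&& j %% 2 == 0, x == m & y == m + 2 * j + 1],
      [&& j %% 2 == 1, x == 0 & y == m + 2 * j + 1],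
      [&& j %% 2 == 1, x == 2 * j + 1 & y == m],
      (x == 2 * j + 2) && (y == 2 * j + 3)
    | (x == m + 2 * j + 2) && (y == m + 2 * j + 3)].
pose d3 : rel nat := fun x y =>
  (x == y) && ((x == m + 2 * j + 1) || (x == m + 2 * j + 2)).
pose e : rel nat := fun x y =>
  [|| (x == 0) && (y == m),
      [&& 2 * j + 1 <= x, x < m & y == x + m],
      [&& 2 * j + 3 <= x, y == x + 1 & y < m],
      [&& m + 2 * j + 3 <= x, y == x + 1 & y < 2 * m],
      (x == m - 1) && (y == m),
      (x == 0) && (y == 2 * m - 1),
      [&& j %% 2 == 1, x == 0 & y == 2 * j + 3],
      [&& j %% 2 == 1, x == m & y == m + 2 * j + 3],
      [&& j %% 2 == 0, x == 0 & y == m + 2 * j + 3],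
      [&& j %% 2 == 0, x == 2 * j + 3 & y == m],
      [&& x %% 2 == 1, x < 2 * j & y == x + 1],
      (x == 2 * j + 1) && (y == 2 * j + 2),
      (x == m + 2 * j + 1) && (y == m + 2 * j + 2),
      [&& x == y, m < x & x <= m + 2 * j]
    | (x == 2 * m) && (y == 2 * m + 1)].
apply: homotopy_equiv_trans.
  apply: (@add_edges_equiv R _ _ d1) => u v _ _ uv.
  exists (if v == m + 2 * j + 3 then 2 * j + 2 else m + 2 * j + 2).
  split.
  - by clear uv; case: ifP => _; lia.
  - clear uv; case: ifP => _; rewrite /ladder_edge /d1; no_clause.
  move=> y _; move: uv; rewrite /linked /ladder_edge /d1.
  case/or4P=> /and3P[/eqP jE /eqP -> /eqP ->];
  case: ifP => [/eqP ?|/eqP ?]; try (exfalso; lia);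
  each_clause.
apply: homotopy_equiv_trans.
  apply: (@eq_label_equiv R _ _ (fun x y => e x y || d2 x y)) => x y _ _;
  rewrite /linked /e /d2 /d1 /ladder_edge;
  (each_clause_with ltac:(case: (leqP x (2 * j + 1)) => ?;
    case: (leqP x (2 * j + 2)) => ?; case: (leqP x (m + 2 * j + 1)) => ?;
    case: (leqP x (m + 2 * j + 2)) => ?)).
apply: homotopy_equiv_trans.
  apply: homotopy_equiv_sym.
  apply: (@add_edges_equiv R _ e d2) => u v _ _ uv.
  exists (if (u == 2 * j + 2) then m + 2 * j + 1 else if u == m + 2 * j + 2
    then 2 * j + 1 else if (u == 2 * j + 1) || (v == 2 * j + 1) then
    m + 2 * j + 2 else 2 * j + 2).
  split.
  - by clear uv; do 3?case: ifP => _; lia.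
  - clear uv; do 3?case: ifP => _; rewrite /e /d2; no_clause.
  move=> y _; move: uv; rewrite /linked /e /d2.
  case/or4P=> [||| /orP[|/orP[]]];
    [move=> /and3P[/eqP jE /eqP -> /eqP ->] .. | |];
    try move=> /andP[/eqP -> /eqP ->];
  do 3?case: ifP => ?; try (exfalso; lia);
  each_clause.
apply: homotopy_equiv_trans.
  apply: (@add_edges_equiv R _ _ d3) => u v _ _ uv.
  exists (if u == m + 2 * j + 1 then 2 * j + 2 else 2 * j + 1).
  split.
  - by clear uv; case: ifP => _; lia.
  - clear uv; case: ifP => _; rewrite /e /d3; no_clause.
  move=> y _; move: uv; rewrite /linked /e /d3.
  case/andP => /eqP <- /orP[/eqP ->|/eqP ->]; case: ifP => ?;
  try (exfalso; lia); each_clause.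
apply: eq_label_equiv => x y _ _; rewrite /linked /e /d3 /ladder_edge;
  (each_clause_with ltac:(case: (leqP x (2 * j)) => ?;
    case: (leqP x (2 * j + 1)) => ?; case: (leqP x (2 * j + 2)) => ?;
    case: (leqP x (m + 2 * j)) => ?; case: (leqP x (m + 2 * j + 1)) => ?;
    case: (leqP x (m + 2 * j + 2)) => ?)).
Qed.

Lemma flag_embed (R : realType) (V W : finType) (c : rel V) (d : rel W)
    (g : W -> V) (w0 : W) :
  symmetric c -> injective g -> (forall u v, c (g u) (g v) = d u v) ->
  (forall x, c x x -> exists u, g u = x) ->
  homotopy_equiv R (flag_real R c) (flag_real R d).
Proof.
move=> csym ginj cg gsurj.
pose f x := odflt w0 [pick u | g u == x].
have gK x : c x x -> g (f x) = x.
  move=> /gsurj[u gu]; rewrite /f; case: pickP => [v /eqP//|/(_ u)].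
  by rewrite gu eqxx.
have fK u : f (g u) = u.
  rewrite /f; case: pickP => [v /eqP/ginj//|/(_ u)]; by rewrite eqxx.
apply: (@flag_contiguity _ _ _ _ _ f g) =>
  // [x y|x y cx cy|x y _ _|x y cx cy|x y _ _].
- by rewrite -!cg csym.
- by rewrite -cg !gK.
- by rewrite cg.
- by rewrite gK.
- by rewrite fK.
Qed.

Lemma label_embed (R : realType) (N : nat) (e : rel nat) (W : finType)
    (d : rel W) (g : W -> nat) (w0 : W) :
  (forall w, g w < N) -> injective g -> symmetric d ->
  (forall u v, e (g u) (g v) -> ~~ d u v) ->
  (forall u v, ~~ d u v -> linked e (g u) (g v)) ->
  (forall x, x < N -> ~~ e x x -> exists u, g u = x) ->
  homotopy_equiv R (flag_real R (@label_compat N e)) (flag_real R d).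
Proof.
move=> gN ginj dsym ed de gsurj.
apply: (@flag_embed _ _ _ _ _ (fun w => Ordinal (gN w)) w0).
- exact: label_compat_sym.
- by move=> u v [/ginj].
- move=> u v; rewrite /label_compat /= -[RHS]negbK; congr (~~ _).
  apply/idP/idP => [/orP[/ed//|/ed]|/de//].
  by rewrite dsym.
- move=> x; rewrite /label_compat /linked orbb => /(gsurj _ (ltn_ord x))[u gu].
  by exists u; apply: val_inj.
Qed.

Lemma cycle_reduce (R : realType) (m j : nat) : 3 * j + 2 <= m ->
  homotopy_equiv R (flag_real R (@label_compat (m + 2) (cycle_edge m 0)))
                   (flag_real R (@label_compat (m + 2) (cycle_edge m j))).
Proof.
elim: j => [|j IHj] jm; first by apply: eq_flag_equiv.
apply: homotopy_equiv_trans (IHj _) (cycle_step _ _); lia.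
Qed.

Lemma ladder_reduce (R : realType) (m j : nat) : 2 * j + 2 <= m ->
  homotopy_equiv R (flag_real R (@label_compat (2 * m + 2) (ladder_edge m 0)))
    (flag_real R (@label_compat (2 * m + 2) (ladder_edge m j))).
Proof.
elim: j => [|j IHj] jm; first by apply: eq_flag_equiv.
apply: homotopy_equiv_trans (IHj _) (ladder_step _ _); lia.
Qed.

Lemma cycle_mod0 (R : realType) (k : nat) :
  homotopy_equiv R
    (flag_real R (@label_compat (3 * k + 3 + 2) (cycle_edge (3 * k + 3) k)))
    (flag_real R (@join_compat k.+1 3)).
Proof.
pose g (w : 'I_k.+1 * bool + 'I_3) : nat :=
  match w with
  | inl (i, b) => if i < k then 3 * i + 1 + b else 3 * k + 3 + b
  | inr r => if r == 0 :> nat then 0 else 3 * k + r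
  end.
have gP (w : 'I_k.+1 * bool + 'I_3) : match w with
  | inl (i, b) => i < k /\ g w = 3 * i + 1 + b \/
                  i = k :> nat /\ g w = 3 * k + 3 + b
  | inr r => r = 0 :> nat /\ g w = 0 \/ 0 < r < 3 /\ g w = 3 * k + r
  end.
  case: w => [[i b]|r] /=.
    by move: (ltn_ord i) => iN; case: ltnP => ik; [left|right]; lia.
  by move: (ltn_ord r) => rN; case: eqP => r0; [left|right]; lia.
clearbody g.
apply: (@label_embed _ _ _ _ _ g (inr ord0)).
- move=> w; move: (gP w); move: (g w) => x.
  by case: w => [[i []]|r]; lia.
- move=> u v; move: (gP u) (gP v); move: (g u) (g v) => x y Hu Hv xy; subst y.
  case: u v Hu Hv => [[i []]|r] [[j []]|s] Hu Hv; try (exfalso; lia).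
  + by have -> : i = j by apply: val_inj => /=; lia.
  + by have -> : i = j by apply: val_inj => /=; lia.
  + by have -> : r = s by apply: val_inj => /=; lia.
- exact: join_compat_sym.
- move=> u v; move: (gP u) (gP v); move: (g u) (g v) => x y.
  case: u v => [[i []]|r] [[j []]|s] Hx Hy;
  rewrite /cycle_edge /= /cross_compat /= -?val_eqE /= ?implybT ?implybF;
  each_clause.
- move=> u v; move: (gP u) (gP v); move: (g u) (g v) => x y.
  case: u v => [[i []]|r] [[j []]|s] Hx Hy;
  rewrite /= /cross_compat /= -?val_eqE /= ?implybT ?implybF //;
  rewrite /linked /cycle_edge => H; 
  case: Hx => ?; case: Hy => ?; case: (leqP x (3 * k + 1)) => ?;
  case: (leqP y (3 * k + 1)) => ?; first [exfalso; lia|some_clause].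
- move=> x xN nx.
  have {}nx : [|| x == 0, 3 * k < x | x %% 3 != 0].
    by move: nx; rewrite /cycle_edge; lia.
  have [x0|x0] := leqP x 0.
    by exists (inr ord0); have := gP (inr ord0) => /=; lia.
  have [xk|xk] := leqP x (3 * k).
    exists (inl (inord (x %/ 3), x %% 3 == 2)).
    move: (gP (inl (inord (x %/ 3), x %% 3 == 2))).
    by rewrite inordK; [case: eqP => /= ?; lia|lia].
  have [xm|xm] := leqP (3 * k + 3) x.
    exists (inl (ord_max, x == 3 * k + 4)).
    by move: (gP (inl (ord_max, x == 3 * k + 4))); case: eqP => /= ?; lia.
  exists (inr (inord (x - 3 * k))).
  by move: (gP (inr (inord (x - 3 * k)))); rewrite /= inordK; lia.
Qed.

Lemma cycle_mod12 (R : realType) (m k : nat) : m = 3 * k + 2 \/ m = 3 * k + 4 ->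
  homotopy_equiv R (flag_real R (@label_compat (m + 2) (cycle_edge m k)))
                   (flag_real R (@cross_compat k.+2)).
Proof.
move=> mE.
pose d : rel nat := fun x y => [&& x == y, 3 * k + 1 < x & x < m].
apply: homotopy_equiv_trans.
  apply: (@add_edges_equiv R _ _ d) => u v _ _ /and3P[/eqP <- u1 um].
  exists (if u == 3 * k + 2 then 0 else 3 * k + 1).
  split.
  - by case: ifP => _; lia.
  - case: ifP => _; rewrite /cycle_edge /d; no_clause.
  move=> y _; rewrite /linked /cycle_edge /d; case: ifP => ?; each_clause.
rewrite /d {d}.
pose g (w : 'I_k.+2 * bool) : nat :=
  if w.1 < k then 3 * w.1 + 1 + w.2
  else if w.1 == k :> nat then if w.2 then 3 * k + 1 else 0 else m + w.2.
have gP (w : 'I_k.+2 * bool) : let: (i, b) := w in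
  i < k /\ g w = 3 * i + 1 + b \/
    (i = k :> nat /\ g w = (if b then 3 * k + 1 else 0) \/
     i = k + 1 :> nat /\ g w = m + b).
  case: w => [i b] /=; rewrite /g /=; move: (ltn_ord i) => iN.
  case: ltnP => ik; [by left|case: eqP => ik'].
    by right; left; lia.
  by right; right; lia.
clearbody g.
apply: (@label_embed _ _ _ _ _ g (ord0, true)).
- move=> w; move: (gP w); move: (g w) => x.
  by case: w => [i []] /=; lia.
- move=> u v; move: (gP u) (gP v); move: (g u) (g v) => x y Hu Hv xy; subst y.
  case: u v Hu Hv => [i []] [j []] Hu Hv; try (exfalso; lia).
  + by have -> : i = j by apply: val_inj => /=; lia.
  + by have -> : i = j by apply: val_inj => /=; lia.
- exact: cross_compat_sym.
- move=> u v; move: (gP u) (gP v); move: (g u) (g v) => x y.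
  case: u v => [i []] [j []] Hx Hy;
  rewrite /cycle_edge /= /cross_compat /= -?val_eqE /= ?implybT ?implybF;
  each_clause.
- move=> u v; move: (gP u) (gP v); move: (g u) (g v) => x y.
  case: u v => [i []] [j []] Hx Hy;
  rewrite /= /cross_compat /= -?val_eqE /= ?implybT ?implybF //;
  rewrite /linked /cycle_edge => H;
  case: Hx => [?|[?|?]]; case: Hy => [?|[?|?]];
  first [exfalso; lia|some_clause].
- move=> x xN nx.
  have {}nx :
      [|| x == 0, x == 3 * k + 1, m <= x | (x <= 3 * k) && (x %% 3 != 0)].
    by move: nx; rewrite /cycle_edge; lia.
  have [xm|xm] := leqP m x.
    exists (ord_max, x == m + 1).
    by move: (gP (ord_max, x == m + 1)); case: eqP => /= ?; lia.
  have [x0|x0] := boolP ((x == 0) || (x == 3 * k + 1)).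
    exists (inord k, x != 0); move: (gP (inord k, x != 0)).
    by rewrite inordK; [case: eqP => /= ?; lia|lia].
  exists (inord (x %/ 3), x %% 3 == 2).
  move: (gP (inord (x %/ 3), x %% 3 == 2)).
  by rewrite inordK; [case: eqP => /= ?; lia|lia].
Qed.

Lemma ladder_odd (R : realType) (m k : nat) : m = 2 * k + 2 -> k %% 2 = 1 ->
  homotopy_equiv R (flag_real R (@label_compat (2 * m + 2) (ladder_edge m k)))
                   (flag_real R (@cross_compat k.+2)).
Proof.
move=> mE kodd.
pose d : rel nat := fun x y => (x == y) && ((x == m - 1) || (x == 2 * m - 1)).
apply: homotopy_equiv_trans.
  apply: (@add_edges_equiv R _ _ d) => u v _ _ /andP[/eqP <- u1].
  exists (if u == m - 1 then 0 else m).
  split.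
  - by case: ifP => _; lia.
  - case: ifP => _; rewrite /ladder_edge /d; no_clause.
  move=> y _; rewrite /linked /ladder_edge /d; case: ifP => ?; each_clause.
rewrite /d {d}.
pose g (w : 'I_k.+2 * bool) : nat :=
  if w.1 < k then 2 * w.1 + 1 + w.2
  else if w.1 == k :> nat then if w.2 then m else 0 else 2 * m + w.2.
have gP (w : 'I_k.+2 * bool) : let: (i, b) := w in
  i < k /\ g w = 2 * i + 1 + b \/
    (i = k :> nat /\ g w = (if b then m else 0) \/
     i = k + 1 :> nat /\ g w = 2 * m + b).
  case: w => [i b] /=; rewrite /g /=; move: (ltn_ord i) => iN.
  case: ltnP => ik; [by left|case: eqP => ik'].
    by right; left; lia.
  by right; right; lia.
clearbody g.
apply: (@label_embed _ _ _ _ _ g (ord0, true)).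
- move=> w; move: (gP w); move: (g w) => x.
  by case: w => [i []]; lia.
- move=> u v; move: (gP u) (gP v); move: (g u) (g v) => x y Hu Hv xy; subst y.
  case: u v Hu Hv => [i []] [j []] Hu Hv; try (exfalso; lia).
  + by have -> : i = j by apply: val_inj => /=; lia.
  + by have -> : i = j by apply: val_inj => /=; lia.
- exact: cross_compat_sym.
- move=> u v; move: (gP u) (gP v); move: (g u) (g v) => x y.
  case: u v => [i []] [j []] Hx Hy;
  rewrite /ladder_edge /= /cross_compat /= -?val_eqE /= ?implybT ?implybF;
  each_clause.
- move=> u v; move: (gP u) (gP v); move: (g u) (g v) => x y.
  case: u v => [i []] [j []] Hx Hy;
  rewrite /= /cross_compat /= -?val_eqE /= ?implybT ?implybF //;
  rewrite /linked /ladder_edge => H;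
  case: Hx => [?|[?|?]]; case: Hy => [?|[?|?]];
  first [exfalso; lia|some_clause].
- move=> x xN nx.
  have {}nx : [|| x == 0, x == m, 2 * m <= x | (0 < x) && (x <= 2 * k)].
    apply: contraNT nx; rewrite /ladder_edge.
    case: (leqP x (m - 1)) => ?; case: (leqP x (m + 2 * k)) => ? ?; some_clause.
  have [xm|xm] := leqP (2 * m) x.
    exists (ord_max, x == 2 * m + 1).
    by move: (gP (ord_max, x == 2 * m + 1)); case: eqP => /= ?; lia.
  have [x0|x0] := boolP ((x == 0) || (x == m)).
    exists (inord k, x != 0); move: (gP (inord k, x != 0)).
    by rewrite inordK; [case: eqP => /= ?; lia|lia].
  exists (inord (x.-1 %/ 2), x %% 2 == 0).
  move: (gP (inord (x.-1 %/ 2), x %% 2 == 0)).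
  by rewrite inordK; [case: eqP => /= ?; lia|lia].
Qed.

Lemma ladder_even (R : realType) (m k : nat) : m = 2 * k + 2 -> k %% 2 = 0 ->
  homotopy_equiv R (flag_real R (@label_compat (2 * m + 2) (ladder_edge m k)))
                   (flag_real R (@join_compat k.+1 4)).
Proof.
move=> mE keven.
pose g (w : 'I_k.+1 * bool + 'I_4) : nat :=
  match w with
  | inl (i, b) => if i < k then 2 * i + 1 + b else 2 * m + b
  | inr r => nth 0 [:: 0; m - 1; m; 2 * m - 1] r
  end.
have gP (w : 'I_k.+1 * bool + 'I_4) : match w with
  | inl (i, b) => i < k /\ g w = 2 * i + 1 + b \/
                  i = k :> nat /\ g w = 2 * m + b
  | inr r => r = 0 :> nat /\ g w = 0 \/ (r = 1 :> nat /\ g w = m - 1 \/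
             (r = 2 :> nat /\ g w = m \/ r = 3 :> nat /\ g w = 2 * m - 1))
  end.
  case: w => [[i b]|r] /=.
    by move: (ltn_ord i) => iN; case: ltnP => ik; [left|right]; lia.
  case: r => -[|[|[|[|//]]]] rN /=.
  - by left.
  - by right; left.
  - by right; right; left.
  - by right; right; right.
clearbody g.
apply: (@label_embed _ _ _ _ _ g (inr ord0)).
- move=> w; move: (gP w); move: (g w) => x.
  by case: w => [[i []]|r]; lia.
- move=> u v; move: (gP u) (gP v); move: (g u) (g v) => x y Hu Hv xy; subst y.
  case: u v Hu Hv => [[i []]|r] [[j []]|s] Hu Hv; try (exfalso; lia).
  + by have -> : i = j by apply: val_inj => /=; lia.
  + by have -> : i = j by apply: val_inj => /=; lia.
  + by have -> : r = s by apply: val_inj => /=; lia.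
- exact: join_compat_sym.
- move=> u v; move: (gP u) (gP v); move: (g u) (g v) => x y.
  case: u v => [[i []]|r] [[j []]|s] Hx Hy;
  rewrite /ladder_edge /= /cross_compat /= -?val_eqE /= ?implybT ?implybF;
  each_clause.
- move=> u v; move: (gP u) (gP v); move: (g u) (g v) => x y.
  case: u v => [[i []]|r] [[j []]|s] Hx Hy;
  rewrite /= /cross_compat /= -?val_eqE /= ?implybT ?implybF //;
  rewrite /linked /ladder_edge => H;
  first [case: Hx => [?|[?|[?|?]]]|case: Hx => [?|?]];
  first [case: Hy => [?|[?|[?|?]]]|case: Hy => [?|?]];
  first [exfalso; lia|some_clause].
- move=> x xN nx.
  have {}nx : [|| x == 0, m - 1 == x, x == m, 2 * m - 1 <= x
                | (0 < x) && (x <= 2 * k)].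
    apply: contraNT nx; rewrite /ladder_edge.
    case: (leqP x (m - 1)) => ?; case: (leqP x (m + 2 * k)) => ? ?; some_clause.
  have [xm|xm] := leqP (2 * m) x.
    exists (inl (ord_max, x == 2 * m + 1)).
    by move: (gP (inl (ord_max, x == 2 * m + 1))); case: eqP => /= ?; lia.
  have [x0|x0] := leqP x 0.
    by exists (inr ord0); have := gP (inr ord0) => /=; lia.
  have [xk|xk] := leqP x (2 * k).
    exists (inl (inord (x.-1 %/ 2), x %% 2 == 0)).
    move: (gP (inl (inord (x.-1 %/ 2), x %% 2 == 0))).
    by rewrite inordK; [case: eqP => /= ?; lia|lia].
  exists (inr (inord (if x == m - 1 then 1 else if x == m then 2 else 3))).
  move: (gP (inr (inord (if x == m - 1 then 1 else if x == m then 2 else 3)))).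
  by rewrite /= inordK; do 2?case: ifP => ?; lia.
Qed.

(** * Reduction of E_(2n+2) *)

(* The disjoint union of K_2 and H: its independence complex is the suspension
   of Ind H. *)
Definition susp_compat (H : sgraph) : rel (bool + H) := fun x y =>
  match x, y with
  | inl a, inl b => a == b
  | inr h, inr k => ~~ edge H h k
  | _, _ => true
  end.

Lemma susp_compat_sym (H : sgraph) : symmetric (@susp_compat H).
Proof. by move=> [a|h] [b|k] //=; rewrite edge_sym. Qed.

Lemma K_edgeE n (i j : idx n) : edge (K_graph n) i j = (odd i != odd j).
Proof.
rewrite /= /pairs_edge; have [->|_] := eqVneq i j; first by rewrite eqxx.
by case: (odd i); case: (odd j).
Qed.

Section AttachToK.
Variables (R : realType) (n : nat) (H : sgraph) (r : K_graph n -> H -> bool).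
Variables (o o' b b' : idx n) (co cb : H).
Hypotheses (oo : odd o) (oo' : odd o') (ob : ~~ odd b) (ob' : ~~ odd b').
Hypotheses (oDo' : o' != o) (bDb' : b' != b).
Hypotheses (roE : forall h, r o h = (h == co)).
Hypotheses (rbE : forall h, r b h = (h == cb)).
Hypotheses (ro' : forall h, r o' h -> edge H co h).
Hypotheses (rb' : forall h, r b' h -> edge H cb h).

Let G := attach r.

Let D : rel G := fun x y =>
  match x, y with
  | inl i, inr h | inr h, inl i =>
      (i == o) && (h == co) || (i == b) && (h == cb)
  | _, _ => false
  end.

Let c : rel G := fun x y => ~~ edge G x y || D x y.

Let D_sym : symmetric D. Proof. by move=> [i|h] [j|k]. Qed.

Let c_sym : symmetric c.
Proof. by move=> x y; rewrite /c edge_sym D_sym. Qed.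

Let c_K i j : c (inl i) (inl j) = (odd i == odd j).
Proof. by rewrite /c /= orbF -[RHS]negbK -K_edgeE. Qed.

Let c_o h : c (inl o) (inr h).
Proof. by rewrite /c /= roE eqxx; case: (h == co). Qed.

Let c_b h : c (inl b) (inr h).
Proof. by rewrite /c /= rbE eqxx; case: (h == cb); rewrite ?orbT. Qed.

Lemma attach_K_equiv :
  homotopy_equiv R (flag_real R (fun x y : G => ~~ edge G x y))
                   (flag_real R (@susp_compat H)).
Proof.
apply: homotopy_equiv_trans (_ : homotopy_equiv R _ (flag_real R c)) _.
  apply: homotopy_equiv_sym.
  have -> : (fun x y : G => ~~ edge G x y) = (fun x y => c x y && ~~ D x y).
    apply/funext => x; apply/funext => y; rewrite /c.
    case Dxy: (D x y); rewrite ?orbF ?andbT // andbF.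
    apply/negbF; move: Dxy; case: x y => [i|h] [j|k] //=.
      by case/orP => /andP[/eqP -> /eqP ->]; rewrite ?roE ?rbE.
    by case/orP => /andP[/eqP -> /eqP ->]; rewrite ?roE ?rbE.
  have oNb : (o' == b) = false by apply/eqP => E; move: ob; rewrite -E oo'.
  have bNo : (b' == o) = false by apply/eqP => E; move: ob'; rewrite E oo.
  have apexo y : y = inl o' \/ c (inl o) y /\ c (inr co) y ->
      c (inl o') y && ~~ D (inl o') y.
    case=> [->|]; first by rewrite c_K eqxx.
    case: y => [i|h]; rewrite ?c_K ?oo ?oo'; first by move=> [-> _].
    rewrite /c /= (negbTE oDo') oNb /= !orbF andbT => -[_].
    exact: contra (@ro' _).
  have apexb y : y = inl b' \/ c (inl b) y /\ c (inr cb) y ->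
      c (inl b') y && ~~ D (inl b') y.
    case=> [->|]; first by rewrite c_K eqxx.
    case: y => [i|h]; rewrite ?c_K ?(negbTE ob) ?(negbTE ob').
      by move=> [-> _].
    rewrite /c /= (negbTE bDb') bNo /= !orbF andbT => -[_].
    exact: contra (@rb' _).
  apply: remove_pairs_equiv => //.
  move=> [i|h] [j|k] //= /orP[] /andP[/eqP -> /eqP ->] _ _ _.
  - exists (inl o') => y Hy; apply: apexo.
    by case: Hy => [->|[? ? ?]]; [left|right].
  - exists (inl b') => y Hy; apply: apexb.
    by case: Hy => [->|[? ? ?]]; [left|right].
  - exists (inl o') => y Hy; apply: apexo.
    by case: Hy => [->|[? ? ?]]; [left|right].
  - exists (inl b') => y Hy; apply: apexb.
    by case: Hy => [->|[? ? ?]]; [left|right].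
pose f (x : G) : bool + H :=
  match x with inl i => inl (odd i) | inr h => inr h end.
pose g (x : bool + H) : G :=
  match x with inl a => inl (if a then o else b) | inr h => inr h end.
apply: (@flag_contiguity _ _ _ _ _ f g) => //.
- exact: susp_compat_sym.
- move=> [i|h] [j|k] _ _; rewrite ?c_K //=.
  by rewrite /c /= orbF.
- move=> [a|h] [a'|k] _ _ //=.
  + by move=> /eqP ->; rewrite c_K eqxx.
  + by move=> _; case: a.
  + by move=> _; rewrite c_sym; case: a'.
  + by rewrite /c /= => ->.
- move=> [i|h] [j|k] _ _ //=.
  + rewrite !c_K => /eqP ->; case: (odd j); first by rewrite oo.
    by rewrite (negbTE ob).
  + by move=> _; rewrite c_sym; case: ifP.
- move=> [a|h] [a'|k] _ _ //=; case: a' => //=.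
  + by rewrite oo.
  + by rewrite (negbTE ob).
Qed.

End AttachToK.

Lemma shiftedE n d i j : i < 2 * n + 2 -> j < 2 * n + 2 -> d <= 2 * n + 2 ->
  shifted n d i j = (j == i + d) || (j + (2 * n + 2) == i + d).
Proof.
rewrite /shifted; move: (2 * n + 2) => M iM jM dM; rewrite (modn_small jM).
have [Mid|idM] := leqP M (i + d); last by rewrite modn_small//; lia.
have -> : (i + d) %% M = i + d - M.
  by rewrite -{1}(subnK Mid) modnDr modn_small//; lia.
lia.
Qed.

Lemma susp_label_equiv (R : realType) (H : sgraph) (lab : H -> nat) (m : nat)
    (e : rel nat) :
  injective lab -> (forall h, lab h < m) ->
  (forall x, x < m -> exists h, lab h = x) ->
  (forall h k, e (lab h) (lab k) -> edge H h k) ->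
  (forall h k, edge H h k -> linked e (lab h) (lab k)) ->
  e m m.+1 ->
  (forall x y, e x y -> m <= maxn x y -> x = m /\ y = m.+1) ->
  homotopy_equiv R (flag_real R (@label_compat (m + 2) e))
                   (flag_real R (@susp_compat H)).
Proof.
move=> labI labm labS eH He em eM.
pose g (x : bool + H) := match x with inl a => m + a | inr h => lab h end.
apply: (@label_embed _ _ _ _ _ g (inl true)).
- by case=> [[]|h] /=; [lia|lia|have := labm h; lia].
- move=> [a|h] [a'|k] /= E.
  + by have -> : a = a' by move: E; case: a; case: a'; lia.
  + by have := labm k; lia.
  + by have := labm h; lia.
  + by rewrite (labI _ _ E).
- exact: susp_compat_sym.
- move=> [a|h] [a'|k] /= E; rewrite ?negbK.
  + by have := eM _ _ E; move: E; case: a; case: a' => // _; lia.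
  + by have := eM _ _ E; have := labm k; lia.
  + by have := eM _ _ E; have := labm h; lia.
  + exact: eH.
- move=> [a|h] [a'|k] //=; last by rewrite negbK; exact: He.
  by rewrite /linked; case: a; case: a' => // _;
    rewrite ?addn0 ?addn1 em ?orbT.
- move=> x xN _; have [xm|xm] := ltnP x m.
    by have [h <-] := labS _ xm; exists (inr h).
  exists (inl (x == m.+1)) => /=; case: eqP => ?; lia.
Qed.

Section OddCase.
Variables (R : realType) (n : nat).
Hypotheses (n3 : 3 <= n) (nodd : odd n).

Let ord (i : nat) (iN : i < 2 * n + 2) : idx n := Ordinal iN.

Lemma E_odd_label_equiv :
  homotopy_equiv R (flag_real R (fun x y : E_odd n => ~~ edge (E_odd n) x y))
    (flag_real R (@label_compat (2 * n.+1 + 2) (ladder_edge n.+1 0))).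
Proof.
have DCE (i j : idx n) : edge (DC_graph n) i j = (i != j) &&
   [|| j == i + 1 :> nat, j + (2 * n + 2) == i + 1,
       (1 <= i <= n + 1) && ((j == i + (n + 1) :> nat) ||
         (j + (2 * n + 2) == i + (n + 1))),
       i == j + 1 :> nat, i + (2 * n + 2) == j + 1 |
       (1 <= j <= n + 1) && ((i == j + (n + 1) :> nat) ||
         (i + (2 * n + 2) == j + (n + 1)))].
  rewrite /= /pairs_edge !shiftedE ?ltn_ord//; try lia.
  by rewrite -!orbA.
have i1 : 1 < 2 * n + 2 by lia.
have i2 : 2 < 2 * n + 2 by lia.
have in2 : n + 2 < 2 * n + 2 by lia.
have in3 : n + 3 < 2 * n + 2 by lia.
apply: homotopy_equiv_trans.
  apply: (@attach_K_equiv R n (DC_graph n) (fun i j : idx n => i == j)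
    (ord i1) (ord in2) (ord i2) (ord in3) (ord i1) (ord i2)).
  - by [].
  - by rewrite /= oddD nodd.
  - by [].
  - by rewrite /= oddD nodd.
  - by rewrite -val_eqE /=; lia.
  - by rewrite -val_eqE /=; lia.
  - by move=> h; rewrite eq_sym.
  - by move=> h; rewrite eq_sym.
  - by move=> h /eqP <-; rewrite DCE -val_eqE /=; lia.
  - by move=> h /eqP <-; rewrite DCE -val_eqE /=; lia.
apply: homotopy_equiv_sym.
apply: (@susp_label_equiv R (DC_graph n) (fun i : idx n => i)).
- exact: val_inj.
- by move=> h; have := ltn_ord h; lia.
- move=> x xn; have xN : x < 2 * n + 2 by lia.
  by exists (ord xN).
- move=> h k; rewrite DCE -val_eqE /=; have := ltn_ord h; have := ltn_ord k.
  move: (nat_of_ord h) (nat_of_ord k) => x y xN yN; rewrite /ladder_edge.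
  by each_clause_with idtac.
- move=> h k; rewrite DCE -val_eqE /=; have := ltn_ord h; have := ltn_ord k.
  move: (nat_of_ord h) (nat_of_ord k) => x y xN yN /andP[xy].
  rewrite /linked /ladder_edge.
  each_clause_with ltac:(case: (leqP x n) => ?; case: (leqP y n) => ?;
   case: (leqP x n.+1) => ?; case: (leqP y n.+1) => ?;
   case: (leqP x 0) => ?; case: (leqP y 0) => ?).
- rewrite /ladder_edge; some_clause.
- move=> x y; rewrite /ladder_edge => H mxy; move: H.
  repeat (case/orP); lia.
Qed.

End OddCase.

Lemma E_even_label_equiv (R : realType) (n : nat) : 3 <= n -> ~~ odd n ->
  homotopy_equiv R (flag_real R (fun x y : E_even n => ~~ edge (E_even n) x y))
    (flag_real R (@label_compat (n.+1 + 2) (cycle_edge n.+1 0))).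
Proof.
move=> n3 neven.
pose lab (h : C_graph n) : nat := val (val h).
have CE (i j : C_graph n) : edge (C_graph n) i j = (lab i != lab j) &&
   [|| lab j == lab i + 2, lab j + (2 * n + 2) == lab i + 2,
       lab i == lab j + 2 | lab i + (2 * n + 2) == lab j + 2].
  rewrite /= /pairs_edge !shiftedE ?ltn_ord//; try lia.
  by rewrite -!orbA -!val_eqE.
have rE (i : idx n) (h : C_graph n) :
    (i == val h) || shifted n (n + 1) (val h) i =
    [|| i == lab h :> nat, i == lab h + (n + 1) :> nat
      | i + (2 * n + 2) == lab h + (n + 1)].
  by rewrite shiftedE ?ltn_ord//; lia.
have n2 : n %% 2 = 0 by rewrite modn2 (negbTE neven).
have lab_odd (h : C_graph n) : lab h %% 2 = 1.
  by rewrite modn2; have := valP h => ->.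
have lab_lt (h : C_graph n) : lab h < 2 * n + 2 by exact: ltn_ord.
have lab_eq (h k : C_graph n) : (h == k) = (lab h == lab k).
  by rewrite -!val_eqE.
have labS x : x < n.+1 -> exists h, lab h = 2 * x + 1.
  move=> xn; have xN : 2 * x + 1 < 2 * n + 2 by lia.
  have xodd : odd (2 * x + 1) by rewrite oddD oddM.
  by exists (exist (fun i : idx n => odd i) (Ordinal xN) xodd).
clearbody lab.
have i1 : 1 < 2 * n + 2 by lia.
have i3 : 3 < 2 * n + 2 by lia.
have in2 : n + 2 < 2 * n + 2 by lia.
have in4 : n + 4 < 2 * n + 2 by lia.
have [c1 c1E] := labS 0 isT.
apply: homotopy_equiv_trans.
  apply: (@attach_K_equiv R n (C_graph n)
    (fun (i : idx n) (c : C_graph n) =>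
       (i == val c) || shifted n (n + 1) (val c) i)
    (Ordinal i1) (Ordinal i3) (Ordinal in2) (Ordinal in4) c1 c1).
  - by [].
  - by [].
  - by rewrite /= oddD (negbTE neven).
  - by rewrite /= oddD (negbTE neven).
  - by [].
  - by rewrite -val_eqE /=; lia.
  - move=> h; rewrite rE lab_eq c1E; have := lab_odd h; have := lab_lt h.
    by move: (lab h) => x /=; lia.
  - move=> h; rewrite rE lab_eq c1E; have := lab_odd h; have := lab_lt h.
    by move: (lab h) => x /=; lia.
  - move=> h; rewrite rE CE c1E; have := lab_odd h; have := lab_lt h.
    by move: (lab h) => x /=; lia.
  - move=> h; rewrite rE CE c1E; have := lab_odd h; have := lab_lt h.
    by move: (lab h) => x /=; lia.
apply: homotopy_equiv_sym.
apply: (@susp_label_equiv R (C_graph n) (fun h => lab h %/ 2)).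
- move=> h k hk; apply/eqP; rewrite lab_eq; move: hk (lab_odd h) (lab_odd k).
  by move: (lab h) (lab k) => x y; lia.
- by move=> h; have := lab_lt h; move: (lab h) => x; lia.
- by move=> x /labS[h hE]; exists h; rewrite hE; lia.
- move=> h k; rewrite CE; move: (lab_odd h) (lab_odd k) (lab_lt h) (lab_lt k).
  move: (lab h) (lab k) => x y xo yo xN yN; rewrite /cycle_edge.
  by each_clause.
- move=> h k; rewrite CE; move: (lab_odd h) (lab_odd k) (lab_lt h) (lab_lt k).
  move: (lab h) (lab k) => x y xo yo xN yN /andP[xy].
  rewrite /linked /cycle_edge.
  each_clause_with ltac:(case: (leqP x 1) => ?; case: (leqP y 1) => ?).
- rewrite /cycle_edge; some_clause.
- move=> x y; rewrite /cycle_edge => H mxy; move: H.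
  repeat (case/orP); lia.
Qed.

Theorem theorem1p3 (R : realType) (n : nat) (hn : (3 <= n)%N) :
  (odd n ->
    (forall k : nat, n = (4 * k + 1)%N ->
       homotopy_equiv R (realization R (Ind (E_graph n)))
                        (sphere_wedge R 3 (2 * k + 1)))
    /\
    (forall k : nat, n = (4 * k + 3)%N ->
       homotopy_equiv R (realization R (Ind (E_graph n)))
                        (sphere R (2 * k + 2))))
  /\
  (~~ odd n ->
    (forall k : nat, n = (6 * k)%N ->
       homotopy_equiv R (realization R (Ind (E_graph n)))
                        (sphere R (2 * k)))
    /\
    (forall k : nat, n = (6 * k + 2)%N ->
       homotopy_equiv R (realization R (Ind (E_graph n)))
                        (sphere_wedge R 2 (2 * k + 1)))
    /\
    (forall k : nat, n = (6 * k + 4)%N ->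
       homotopy_equiv R (realization R (Ind (E_graph n)))
                        (sphere R (2 * k + 2)))).
Proof.
rewrite realization_Ind; split=> [nodd|neven].
  have -> : E_graph n = E_odd n by rewrite /E_graph nodd.
  have E2 j (jn : 2 * j + 2 <= n.+1) := homotopy_equiv_trans
    (E_odd_label_equiv R hn nodd) (ladder_reduce R jn).
  split=> k nE.
    have kn : 2 * (2 * k) + 2 <= n.+1 by lia.
    apply: homotopy_equiv_trans (E2 _ kn) _.
    apply: homotopy_equiv_trans (@ladder_even R _ _ _ _) _; [lia|lia|].
    by rewrite addn1; exact: join_wedge_equiv.
  have kn : 2 * (2 * k + 1) + 2 <= n.+1 by lia.
  apply: homotopy_equiv_trans (E2 _ kn) _.
  apply: homotopy_equiv_trans (@ladder_odd R _ _ _ _) _; [lia|lia|].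
  have -> : (2 * k + 1).+2 = (2 * k + 2).+1 by lia.
  exact: cross_sphere_equiv.
have -> : E_graph n = E_even n by rewrite /E_graph (negbTE neven).
have E2 j (jn : 3 * j + 2 <= n.+1) := homotopy_equiv_trans
  (E_even_label_equiv R hn neven) (cycle_reduce R jn).
split; [|split] => k nE.
- have kn : 3 * (2 * k - 1) + 2 <= n.+1 by lia.
  apply: homotopy_equiv_trans (E2 _ kn) _.
  apply: homotopy_equiv_trans (@cycle_mod12 R _ _ _) _; first lia.
  have -> : (2 * k - 1).+2 = (2 * k).+1 by lia.
  exact: cross_sphere_equiv.
- have kn : 3 * (2 * k) + 2 <= n.+1 by lia.
  apply: homotopy_equiv_trans (E2 _ kn) _.
  have -> : n.+1 = 3 * (2 * k) + 3 by lia.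
  apply: homotopy_equiv_trans (@cycle_mod0 R _) _.
  by rewrite addn1; exact: join_wedge_equiv.
- have kn : 3 * (2 * k + 1) + 2 <= n.+1 by lia.
  apply: homotopy_equiv_trans (E2 _ kn) _.
  apply: homotopy_equiv_trans (@cycle_mod12 R _ _ _) _; first lia.
  have -> : (2 * k + 1).+2 = (2 * k + 2).+1 by lia.
  exact: cross_sphere_equiv.
Qed.
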